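(* Let $G^{\varphi}$ be a connected complex unit gain graph with underlying graph $G$. Then $n(G^{\varphi})=m(G)+c(G)$ if and only if the following three conditions all hold: (a) any two (distinct) cycles of $G^{\varphi}$ share no common vertices; (b) each cycle of $G^{\varphi}$ is of Type D; (c) $m(T_{G})=m(G-O(G))$.
   Context: All graphs are finite and simple (no loops or multiple edges). A complex unit gain graph $G^{\varphi}$ consists of a graph $G$ (the underlying graph) with vertices $v_1,\dots,v_n$ and a function $\varphi$ assigning to each oriented edge $e_{ij}$ (from $v_i$ to $v_j$, where $v_iv_j\in E(G)$; both orientations of each edge are considered) a number $\varphi(e_{ij})=\varphi_{v_iv_j}\in\mathbb{T}=\{z\in\mathbb{C}:|z|=1\}$ such that $\varphi(e_{ij})=\varphi(e_{ji})^{-1}=\overline{\varphi(e_{ji})}$. Its adjacency matrix $A(G^{\varphi})$ is the $n\times n$ Hermitian matrix with $(i,j)$ entry $\varphi(e_{ij})$ if $v_iv_j\in E(G)$ and $0$ otherwise. $n(G^{\varphi})$ denotes the number of negative eigenvalues of $A(G^{\varphi})$, counted with multiplicity. $m(G)$ is the matching number of $G$ (with $m=0$ for a graph without vertices). $c(G)=|E(G)|-|V(G)|+\omega(G)$ is the cyclomatic number, where $\omega(G)$ is the number of connected components of $G$. Cycles of $G^{\varphi}$ are the cycles of $G$ with the restricted gains; $G^{\varphi}$ is connected if $G$ is. For a cycle $C_q$ with consecutive vertices $w_1,w_2,\dots,w_q$, $q\ge 3$, put $\varphi(C_q)=\varphi_{w_1w_2}\varphi_{w_2w_3}\cdots\varphi_{w_{q-1}w_q}\varphi_{w_qw_1}$.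 The cycle is of Type D if $q$ is odd and $\mathrm{Re}\left((-1)^{(q-1)/2}\varphi(C_q)\right)<0$, where $\mathrm{Re}$ is the real part (this does not depend on the starting vertex or direction). $O(G)$ is the set of vertices lying on cycles of $G$, and $G-O(G)$ is the induced subgraph obtained by deleting these vertices. When the cycles of $G$ are pairwise vertex-disjoint, $T_G$ is the acyclic graph obtained from $G$ by contracting each cycle of $G$ to a single vertex (so $T_G=G$ if $G$ has no cycles); condition (c) is understood together with condition (a), under which $T_G$ is defined. *)

(* Defs.v *)
From HB Require Import structures.
From mathcomp Require Import all_boot all_order all_algebra.
From mathcomp Require Import boolp reals complex.

Set Implicit Arguments.
Unset Strict Implicit.
Unset Printing Implicit Defensive.

Import Order.TTheory GRing.Theory Num.Theory.
Local Open Scope ring_scope.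

Record sgraph := SGraph {
  vertex :> finType;
  adj : rel vertex;
  adj_sym : symmetric adj;
  adj_irrefl : irreflexive adj }.

Definition edges (G : sgraph) : {set {set G}} :=
  [set [set p.1; p.2] | p in [set p : G * G | adj p.1 p.2]].

Definition connected (G : sgraph) : Prop :=
  forall x y : G, connect (@adj G) x y.

Definition num_components (G : sgraph) : nat := n_comp (@adj G) predT.

Definition cyclomatic (G : sgraph) : int :=
  #|edges G|%:Z - #|G|%:Z + (num_components G)%:Z.

Definition matching (G : sgraph) (M : {set {set G}}) : bool :=
  (M \subset edges G) && trivIset M.

Definition matching_number (G : sgraph) : nat :=
  \max_(M : {set {set G}} | matching M) #|M|.

Section Delete.
Variables (G : sgraph) (X : {set G}).

Let dvertex : finType := {x : G | x \notin X}.
Let dadj : rel dvertex := fun x y => adj (val x) (val y).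

Fact dadj_sym : symmetric dadj.
Proof. by move=> x y; rewrite /dadj adj_sym. Qed.

Fact dadj_irrefl : irreflexive dadj.
Proof. by move=> x; rewrite /dadj adj_irrefl. Qed.

Definition delete : sgraph := SGraph dadj_sym dadj_irrefl.
End Delete.

(* A cycle (as a subgraph) is represented by any listing w_1, ..., w_q of its *)
(* consecutive vertices; two listings represent the same cycle iff they have  *)
(* the same cycle_edges (the same vertices would not suffice, e.g. in K_4).   *)
Definition is_cycle (G : sgraph) (c : seq G) : bool :=
  (2 < size c)%N && ucycleb (@adj G) c.

Definition cycle_edges (G : sgraph) (c : seq G) : {set {set G}} :=
  [set [set x; next c x] | x in c].

Definition cycles_disjoint (G : sgraph) : Prop :=
  forall c1 c2 : seq G, is_cycle c1 -> is_cycle c2 ->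
    cycle_edges c1 <> cycle_edges c2 -> [disjoint c1 & c2].

Definition cycle_supports (G : sgraph) : {set {set G}} :=
  [set X : {set G} | `[< exists2 c : seq G, is_cycle c & X = [set x in c] >]].

Definition on_cycles (G : sgraph) : {set G} := cover (cycle_supports G).

(* The graph T_G obtained by contracting each cycle to a vertex. A vertex of  *)
(* T_G is encoded by the set of vertices of G it comes from: the vertex set   *)
(* of a cycle, or {x} with x on no cycle. The definition is meaningful only   *)
(* under cycles_disjoint G: distinct cycles then have distinct vertex sets,   *)
(* and no two edges of G between distinct blocks become parallel.             *)
Section Contract.
Variable G : sgraph.

Definition contract_blocks : {set {set G}} :=
  cycle_supports G :|: [set [set x] | x in ~: on_cycles G].

Let cvertex : finType := {B : {set G} | B \in contract_blocks}.
Let cadj : rel cvertex := fun B1 B2 =>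
  (B1 != B2) && [exists x in val B1, exists y in val B2, adj x y].

Fact cadj_sym : symmetric cadj.
Proof.
suff sub B1 B2 : cadj B1 B2 -> cadj B2 B1 by move=> B1 B2; apply/idP/idP; apply: sub.
move=> /andP[nB /exists_inP[x xB1 /exists_inP[y yB2 xy]]].
rewrite /cadj eq_sym nB /=; apply/exists_inP; exists y => //.
by apply/exists_inP; exists x; rewrite // adj_sym.
Qed.

Fact cadj_irrefl : irreflexive cadj.
Proof. by move=> B; rewrite /cadj eqxx. Qed.

Definition contract_cycles : sgraph := SGraph cadj_sym cadj_irrefl.
End Contract.

(* Only the values of gain on pairs of adjacent vertices are meaningful.      *)
Record gain_graph (C : numClosedFieldType) := GainGraph {
  underlying :> sgraph;
  gain : underlying -> underlying -> C;
  gain_norm : forall x y, adj x y -> `|gain x y| = 1;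
  gain_inv : forall x y, adj x y -> gain x y = (gain y x)^-1 }.

Section GainGraph.
Variables (C : numClosedFieldType) (G : gain_graph C).

Definition adjacency : 'M[C]_#|G| :=
  \matrix_(i, j) if adj (enum_val i : G) (enum_val j)
                 then gain (enum_val i : G) (enum_val j) else 0.

Definition cycle_gain (c : seq G) : C := \prod_(x <- c) gain x (next c x).

Definition typeD (c : seq G) : Prop :=
  odd (size c) /\ 'Re ((-1) ^+ (size c).-1./2 * cycle_gain c) < 0.
End GainGraph.

(* The eigenvalues of A, listed with their algebraic multiplicities.          *)
Definition eigenvalues (C : numClosedFieldType) n (A : 'M[C]_n) : seq C :=
  sval (closed_field_poly_normal (char_poly A)).

(* In the order of a numClosedFieldType, z < 0 means that z is real negative. *)
Definition neg_inertia (C : numClosedFieldType) (G : gain_graph C) : nat :=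
  count (fun z => z < 0) (eigenvalues (adjacency G)).

(* Main.v *)
Require Import Defs.
From mathcomp Require Import all_boot all_order all_algebra.
From mathcomp Require Import boolp reals complex.
From mathcomp Require Import zify ring.
Import Order.TTheory GRing.Theory Num.Theory.
Local Open Scope ring_scope.

(* Deleting a vertex v changes n by at most 1 and never increases m or c; if v  *)
(* lies on a cycle then c drops. Deleting the neighbour of a pendant vertex     *)
(* lowers n and m by exactly 1. Hence n <= m + c by induction, and equality     *)
(* (tightness) is inherited by both kinds of deletion.                          *)
(*   (=>) In a tight graph every deletion lowers c by at most 1, so cycles are  *)
(* disjoint. Some maximum matching M misses a vertex of each cycle. Deleting    *)
(* such vertices of the cycles other than C, then the neighbours of pendant     *)
(* vertices, reduces the graph to C alone while M stays maximum: so C is of     *)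
(* type D and M has (q-1)/2 edges inside C. Therefore no edge of M leaves a     *)
(* cycle, and m(G) <= m(G - O) + sum (q-1)/2; lifting a matching of T_G gives   *)
(* m(T_G) + sum (q-1)/2 <= m(G).                                                *)
(*   (<=) Koenig's theorem for the forest T_G and (c) give a set K of vertices  *)
(* on no cycle that covers all non-cycle edges, and a matching N of G - O with  *)
(* |K| <= |N|. If K is nonempty, acyclicity provides an edge of N with a        *)
(* pendant end, and its end in K is deleted; otherwise the graph is a disjoint  *)
(* union of type D cycles and isolated vertices. There a vertex u of an odd     *)
(* cycle is split off by a vector f with f_u = 1 and f A = lambda e_u, where    *)
(* lambda = 2 Re((-1)^((q-1)/2) phi(C)).                                        *)

(** Call a subgraph tight when n = m + c. Everything is proved for arbitrary spanning subgraphs of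
    [G], given as relations on its vertices, so that inductions can delete vertices; [tightP] is the
    case of [G] itself.

    Negative inertia is treated as the largest dimension of a subspace on which the Hermitian form
    is negative definite ([negdef_leq], [negdef_exists]). Cutting or enlarging such subspaces shows
    how n reacts to a deletion: it drops by at most 1 at any vertex, by at least 1 at the neighbour
    of a pendant vertex, and at a suitable vertex of an isolated odd cycle according to the sign
    that defines Type D ([ninertia_odd_cycle]). On the combinatorial side, [cyc_remove] turns
    questions about c into questions about bridges. Together these give n <= m + c ([ninertia_le]).

    Necessity. Tightness survives the deletion of a cycle vertex or of the neighbour of a pendant
    vertex, because all the inequalities used must be equalities. This forces disjoint cycles
    ([tight_rdisjoint]), and dismantling the graph around one cycle ([tight_cycle_typeD]) shows that
    it is of Type D and carries (q-1)/2 edges of one fixed maximum matching. That matching then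
    splits into edges off the cycles and edges inside them ([special_matching_le]), while a matching
    of T_G lifts to G and extends inside the cycles ([matching_number_contract]). Comparison gives
    m(T_G) <= m(G - O(G)); the converse inequality holds because G - O(G) embeds in T_G.

    Sufficiency. T_G is a forest, so it has a vertex cover of size at most m(T_G) = m(G - O(G)).
    Counting against a maximum matching of G - O(G) shows that this cover avoids the contracted
    cycles, hence comes from a set of vertices of G. [lower_bound] uses it to find deletions under
    which n >= m + c passes from the smaller graph back to the larger one. *)

Set Implicit Arguments.
Unset Strict Implicit.
Unset Printing Implicit Defensive.

(** * Inertia of Hermitian matrices *)

Section Inertia.
Local Open Scope sesquilinear_scope.
Variable C : numClosedFieldType.

Definition neg_count n (A : 'M[C]_n) : nat :=
  count (fun z => z < 0) (eigenvalues A).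

Definition hform n (A : 'M[C]_n) (u v : 'rV[C]_n) : C :=
  (u *m A *m v ^t*) 0 0.

(** Negativity at every nonzero [u] forces the rows of [W] to be independent, so the form is
    negative definite on a subspace of dimension [k]. *)
Definition negdef n (A : 'M[C]_n) k (W : 'M[C]_(k, n)) :=
  forall u : 'rV_k, u != 0 -> hform A (u *m W) (u *m W) < 0.

(** Deletion of an index at fixed size: the zeroed row and column only contribute an eigenvalue
    0. *)
Definition isolate_mx n (i : 'I_n) (A : 'M[C]_n) : 'M[C]_n :=
  \matrix_(k, l) if (k == i) || (l == i) then 0 else A k l.

Lemma hformDl n (A : 'M[C]_n) u1 u2 v :
  hform A (u1 + u2) v = hform A u1 v + hform A u2 v.
Proof. by rewrite /hform !mulmxDl mxE. Qed.

Lemma hformDr n (A : 'M[C]_n) u v1 v2 :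
  hform A u (v1 + v2) = hform A u v1 + hform A u v2.
Proof. by rewrite /hform linearD map_mxD mulmxDr mxE. Qed.

Lemma hformZl n (A : 'M[C]_n) a u v : hform A (a *: u) v = a * hform A u v.
Proof. by rewrite /hform -!scalemxAl mxE. Qed.

Lemma hformZr n (A : 'M[C]_n) a u v : hform A u (a *: v) = a^* * hform A u v.
Proof. by rewrite /hform linearZ map_mxZ -scalemxAr mxE. Qed.

Lemma hformC n (A : 'M[C]_n) u v : A ^t* = A -> hform A v u = (hform A u v)^*.
Proof.
move=> Ah; rewrite /hform.
have -> : v *m A *m u ^t* = (u *m A *m v ^t*) ^t*.
  by rewrite !trmx_mul !map_mxM trmxCK Ah mulmxA.
by rewrite !mxE.
Qed.

Lemma char_poly_conj n (S A : 'M[C]_n) : S \in unitmx ->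
  char_poly (invmx S *m A *m S) = char_poly A.
Proof.
move=> Su; rewrite /char_poly.
have -> : char_poly_mx (invmx S *m A *m S) =
    map_mx polyC (invmx S) *m char_poly_mx A *m map_mx polyC S.
  rewrite /char_poly_mx mulmxBr mulmxBl -!map_mxM; congr (_ - _).
  by rewrite scalar_mxC -mulmxA -map_mxM mulVmx // map_mx1 mulmx1.
rewrite !det_mulmx mulrAC -det_mulmx -map_mxM mulVmx // map_mx1 det1.
by rewrite mul1r.
Qed.

Lemma herm_diag n (A : 'M[C]_n) : A ^t* = A ->
  exists (S : 'M[C]_n) (d : 'rV[C]_n),
  [/\ S \is unitarymx, forall i, d 0 i \is Num.real,
      A = S ^t* *m diag_mx d *m S &
      neg_count A = #|[pred i | d 0 i < 0]|].
Proof.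
move=> Ah; have AH : A \is hermsymmx.
  by apply/is_hermitianmxP; rewrite expr0 scale1r Ah.
have Adiag := orthomx_spectralP (hermitian_normalmx AH).
exists (spectralmx A), (spectral_diag A); split.
- exact: spectral_unitarymx.
- by move=> i; apply: (mxOverP (hermitian_spectral_diag_real AH)).
- by rewrite {1}Adiag invmx_unitary ?spectral_unitarymx.
rewrite /neg_count /eigenvalues; case: closed_field_poly_normal => /= s.
rewrite (monicP (char_poly_monic A)) scale1r.
have -> : char_poly A = \prod_i ('X - (spectral_diag A 0 i)%:P).
  rewrite [in LHS]Adiag.

  rewrite char_poly_conj ?spectral_unit // char_poly_trig ?diag_mx_is_trig //.
  by apply: eq_bigr => i _; rewrite !mxE eqxx mulr1n.
rewrite -(big_map (fun i => spectral_diag A 0 i) predT (fun z => 'X - z%:P)).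
move=> /prod_XsubC_eq /permP <-.
by rewrite -sum1_count big_map sum1_card.
Qed.

Lemma hform_diag n (S : 'M[C]_n) (d : 'rV[C]_n) u :
  hform (S ^t* *m diag_mx d *m S) u u =
  \sum_i `|(u *m S ^t*) 0 i| ^+ 2 * d 0 i.
Proof.
rewrite /hform !mulmxA -[_ *m S *m _]mulmxA.
have -> : S *m u ^t* = (u *m S ^t*) ^t* by rewrite trmx_mul map_mxM trmxCK.
rewrite mxE; apply: eq_bigr => i _.
by rewrite mul_mx_diag !mxE mulrAC normCK.
Qed.

(** With more rows than negative eigenvalues, some nonzero combination of the rows has all its
    coordinates along negative eigenvectors equal to 0, and the form is nonnegative there. *)
Lemma negdef_leq n (A : 'M[C]_n) k (W : 'M_(k, n)) : A ^t* = A ->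
  negdef A W -> (k <= neg_count A)%N.
Proof.
move=> Ah negW; have [S [d [_ dreal eqA ->]]] := herm_diag Ah.
rewrite leqNgt; apply/negP => lt_k.
pose Z : 'M_(k, #|[pred i | d 0 i < 0]|) :=
  \matrix_(i, j) (W *m S ^t*) i (enum_val j).
have : kermx Z != 0.
  by rewrite -mxrank_eq0 mxrank_ker -lt0n subn_gt0 (leq_ltn_trans (rank_leq_col Z)).
case/rowV0Pn => u /sub_kermxP uZ u0.
have := negW u u0; rewrite eqA hform_diag le_gtF //.
apply: sumr_ge0 => i _; have [di|di] := boolP (d 0 i < 0).
  have -> : (u *m W *m S ^t*) 0 i = 0.
    have eq0 : (u *m Z) 0 (enum_rank_in (di : i \in [pred i | d 0 i < 0]) i) = 0.
      by rewrite uZ mxE.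
    rewrite mxE in eq0; rewrite -mulmxA mxE -[RHS]eq0.
    by apply: eq_bigr => j _; rewrite [Z _ _]mxE enum_rankK_in.
  by rewrite normr0 expr0n mul0r.
by rewrite mulr_ge0 ?exprn_ge0 // real_leNgt ?real0.
Qed.

Lemma negdef_exists n (A : 'M[C]_n) k : A ^t* = A -> (k <= neg_count A)%N ->
  exists W : 'M_(k, n), negdef A W.
Proof.
move=> Ah; have [S [d [Su dreal eqA ->]]] := herm_diag Ah => le_k.
pose w i : 'I_n := enum_val (widen_ord le_k i).
have w_inj : injective w.
  by move=> i j /enum_val_inj eq_ij; apply/val_inj/(congr1 val eq_ij).
exists (\matrix_(i < k) row (w i) S) => u u0.
rewrite eqA hform_diag.
have eu j : (u *m (\matrix_(i < k) row (w i) S) *m S ^t*) 0 j =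
    \sum_i u 0 i * (w i == j)%:R.
  rewrite -mulmxA mxE; apply: eq_bigr => i _; congr (_ * _).
  have := unitarymxP Su => /matrixP /(_ (w i) j); rewrite !mxE => <-.
  by apply: eq_bigr => l _; rewrite !mxE.
have euw i : \sum_j u 0 j * (w j == w i)%:R = u 0 i.
  rewrite (bigD1 i) //= eqxx mulr1 big1 ?addr0 // => j ji.
  by rewrite (inj_eq w_inj) (negPf ji) mulr0.
have /rV0Pn[i ui] := u0.
rewrite (bigD1 (w i)) //= eu euw ltr_wnDr //.
  apply: sumr_le0 => j _; rewrite eu.
  have [[i' <-]|nj] := pselect (exists i', w i' = j).
    by rewrite mulr_ge0_le0 ?exprn_ge0 // ltW //; apply: (enum_valP (widen_ord le_k i')).
  rewrite big1 ?normr0 ?expr0n ?mul0r // => i' _.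
  by case: eqP => [eq_j|]; [case: nj; exists i' | rewrite mulr0].
rewrite nmulr_llt0 ?exprn_gt0 ?normr_gt0 //.
by have := enum_valP (widen_ord le_k i).
Qed.

Definition mask_mx n (i : 'I_n) : 'M[C]_n := diag_mx (\row_j (j != i)%:R).

Lemma isolate_mxE n i (A : 'M[C]_n) :
  isolate_mx i A = mask_mx i *m A *m mask_mx i.
Proof.
apply/matrixP => k l; rewrite /mask_mx mul_mx_diag mul_diag_mx !mxE.
by case: eqP; case: eqP; rewrite ?(mulr0, mul0r, mulr1, mul1r).
Qed.

Lemma mask_mxC n i : (@mask_mx n i) ^t* = mask_mx i.
Proof.
by rewrite /mask_mx tr_diag_mx map_diag_mx; congr diag_mx; apply/rowP => j; rewrite !mxE rmorph_nat.
Qed.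

Lemma isolate_mx_herm n i (A : 'M[C]_n) :
  A ^t* = A -> (isolate_mx i A) ^t* = isolate_mx i A.
Proof.
by move=> Ah; rewrite isolate_mxE !trmx_mul !map_mxM mask_mxC Ah mulmxA.
Qed.

Lemma mul_mask n i k (W : 'M[C]_(k, n)) : col i W = 0 -> W *m mask_mx i = W.
Proof.
move=> /colP W0; apply/matrixP => a b; rewrite /mask_mx mul_mx_diag !mxE.
case: eqP => [->|_]; rewrite ?mulr1 // mulr0.
by have := W0 a; rewrite !mxE.
Qed.

Lemma mask_col n i k (W : 'M[C]_(k, n)) : col i (W *m mask_mx i) = 0.
Proof. by apply/colP => a; rewrite /mask_mx mul_mx_diag !mxE eqxx mulr0. Qed.

Lemma hform_isolate n i (A : 'M[C]_n) u v :
  hform (isolate_mx i A) u v = hform A (u *m mask_mx i) (v *m mask_mx i).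
Proof.
rewrite /hform isolate_mxE [(v *m _)^T]trmx_mul map_mxM mask_mxC.
by rewrite !mulmxA.
Qed.

Lemma negdef_isolateW n i (A : 'M[C]_n) k (W : 'M_(k, n)) :
  negdef (isolate_mx i A) W -> negdef A (W *m mask_mx i).
Proof. by move=> negW u u0; rewrite mulmxA -hform_isolate negW. Qed.

Lemma col_mul k l n (B : 'M[C]_(k, l)) (D : 'M_(l, n)) i :
  col i (B *m D) = B *m col i D.
Proof. by rewrite !colE mulmxA. Qed.

(** Interlacing: the hyperplane where coordinate [i] vanishes cuts a negative definite subspace in
    codimension at most 1. *)
Lemma neg_count_isolate_ge n i (A : 'M[C]_n) : A ^t* = A ->
  (neg_count A <= (neg_count (isolate_mx i A)).+1)%N.
Proof.
move=> Ah; have [W negW] := negdef_exists Ah (leqnn _).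
move: (neg_count A) W negW => [//|k] W negW; rewrite ltnS.
pose K := kermx (col i W).
have rK : (k <= \rank K)%N.
  have := rank_leq_col (col i W); rewrite mxrank_ker.
  by case: (\rank _) => [|[|//]] _; rewrite ?subn0 ?subn1.
pose Z : 'M_(k, k.+1) := pid_mx k *m row_base K.
have Zfree (u : 'rV_k) : u *m Z = 0 -> u = 0.
  move=> /eqP; rewrite mulmxA mulmx_free_eq0 ?row_base_free // mulmx_free_eq0.
    by move/eqP.
  by rewrite /row_free rank_pid_mx.
have ZW : col i (Z *m W) = 0.
  rewrite col_mul -mulmxA; apply/eqP.
  have /sub_kermxP -> : (row_base K <= kermx (col i W))%MS by rewrite eq_row_base.
  by rewrite mulmx0.
apply: (@negdef_leq _ _ _ (Z *m W)) => [|u u0]; first exact: isolate_mx_herm.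
rewrite hform_isolate -mulmxA mul_mask // mulmxA negW //.
by apply: contra u0 => /eqP /Zfree ->.
Qed.

Lemma negdef_extend n (A : 'M[C]_n) k (W : 'M_(k, n)) (f : 'rV_n) :
  A ^t* = A -> negdef A W -> hform A f f < 0 ->
  (forall u : 'rV_k, hform A (u *m W) f = 0) -> negdef A (col_mx W f).
Proof.
move=> Ah negW negf ortho u u0.
rewrite -[u]hsubmxK mul_row_col.
set a := lsubmx u; set b := rsubmx u.
have -> : b *m f = b 0 0 *: f by rewrite [b]mx11_scalar mul_scalar_mx !mxE.
rewrite !(hformDl, hformDr, hformZl, hformZr) [hform A f _]hformC // ortho.
rewrite conjC0 !mulr0 addr0 add0r mulrA -normCK.
have [a0|a0] := eqVneq a 0.
  rewrite a0 mul0mx /hform !mul0mx mxE add0r nmulr_llt0 // exprn_gt0 // normr_gt0.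
  apply: contra u0 => b0; rewrite -[u]hsubmxK -/a -/b a0 [b]mx11_scalar (eqP b0).
  by rewrite raddf0 row_mx0.
by rewrite ltr_wnDr ?negW // mulr_ge0_le0 ?exprn_ge0 // ltW.
Qed.

(** Since [f A] is a multiple of the unit vector at [i], [f] is orthogonal for the form to the
    hyperplane where coordinate [i] vanishes. Its value [lam] is negative, so [f] adds a
    dimension. *)
Lemma neg_count_eigvec_lt n (A : 'M[C]_n) i (f : 'rV_n) (lam : C) :
  A ^t* = A -> f 0 i = 1 -> f *m A = lam *: delta_mx 0 i -> lam < 0 ->
  ((neg_count (isolate_mx i A)).+1 <= neg_count A)%N.
Proof.
move=> Ah fi fA lam0.
have [W /negdef_isolateW negW] := negdef_exists (isolate_mx_herm i Ah) (leqnn _).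
have fform v : hform A f v = lam * (v 0 i)^*.
  rewrite /hform fA -scalemxAl mxE; congr (_ * _).
  by rewrite -rowE !mxE.
rewrite -addn1; apply: (@negdef_leq _ _ _ (col_mx (W *m mask_mx i) f)) => //.
apply: negdef_extend => //; first by rewrite fform fi conjC1 mulr1.
move=> u; rewrite hformC // fform mulmxA.
have /colP/(_ 0) := mask_col i (u *m W); rewrite !mxE => ->.
by rewrite conjC0 mulr0 conjC0.
Qed.

(** Projecting along [f] onto the hyperplane where coordinate [i] vanishes lowers the form by [lam]
    times a squared modulus, so a negative definite subspace stays negative definite and keeps its
    dimension. *)
Lemma neg_count_eigvec_ge n (A : 'M[C]_n) i (f : 'rV_n) (lam : C) :
  A ^t* = A -> f 0 i = 1 -> f *m A = lam *: delta_mx 0 i -> 0 <= lam ->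
  (neg_count A <= neg_count (isolate_mx i A))%N.
Proof.
move=> Ah fi fA lam0.
have fform v : hform A f v = lam * (v 0 i)^*.
  rewrite /hform fA -scalemxAl mxE; congr (_ * _).
  by rewrite -rowE !mxE.
have [W negW] := negdef_exists Ah (leqnn _).
apply: (@negdef_leq _ _ _ (W - col i W *m f)) => [|u u0].
  exact: isolate_mx_herm.
have Wi : col i (W - col i W *m f) = 0.
  by apply/colP => a; rewrite !mxE big_ord1 !mxE fi mulr1 subrr.
rewrite hform_isolate -mulmxA mul_mask //; apply: le_lt_trans (negW _ u0).
set w := u *m (W - _); set c := (u *m W) 0 i.
have eW : u *m W = w + c *: f.
  rewrite /w mulmxBr mulmxA [u *m col i W]mx11_scalar mul_scalar_mx.
  by rewrite -col_mul [col _ _ _ _]mxE subrK.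
have w0 : w 0 i = 0 by have /colP/(_ 0) := congr1 (mulmx u) Wi; rewrite -col_mul mulmx0 !mxE.
rewrite eW !(hformDl, hformDr, hformZl, hformZr) [hform A w f]hformC // !fform.
rewrite w0 fi conjC0 conjC1 !mulr0 conjC0 !mulr0 addr0 add0r mulr1.
by rewrite lerDl mulrA -normCK mulr_ge0 ?exprn_ge0.
Qed.

(** The unit vectors at [i] and [j] span a hyperbolic plane. A negative definite subspace for the
    isolated matrix can be made orthogonal to that plane, which then contributes the negative vector
    [e i - a *: e j], of value -2|a|^2. *)
Lemma neg_count_pendant n (A : 'M[C]_n) i j : A ^t* = A -> A i j != 0 ->
  A j j = 0 -> i != j -> (forall l, l != j -> A i l = 0) ->
  ((neg_count (isolate_mx j A)).+1 <= neg_count A)%N.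
Proof.
move=> Ah aij ajj ij ail; set a := A i j in aij.
have [W0 /negdef_isolateW] := negdef_exists (isolate_mx_herm j Ah) (leqnn _).
set W := W0 *m _ => negW.
have Wj (u : 'rV_(neg_count (isolate_mx j A))) : (u *m W) 0 j = 0.
  by rewrite mulmxA; have /colP/(_ 0) := mask_col j (u *m W0); rewrite !mxE.
pose e k : 'rV[C]_n := delta_mx 0 k.
have formi v : hform A (e i) v = a * (v 0 j)^*.
  rewrite /hform -rowE mxE (bigD1 j) //= big1 ?addr0 ?mxE // => l lj.
  by rewrite !mxE ail ?mul0r.
have formj v : hform A v (e j) = (v *m col j A) 0 0.
  rewrite /hform colE mulmxA; congr (fun_of_matrix (_ *m _) _ _).
  by apply/matrixP => k l; rewrite !mxE andbC rmorph_nat.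
(* This coefficient makes [W'] orthogonal to [e j]. Adding multiples of [e i] does not alter the
   form on rows whose coordinate [j] is 0, because [e i] is orthogonal to them. *)
pose c : 'cV_(neg_count (isolate_mx j A)) := - a^-1 *: (W *m col j A).
pose W' := W + c *m e i.
have eW' (u : 'rV_(neg_count (isolate_mx j A))) : u *m W' = u *m W + (u *m c) 0 0 *: e i.
  by rewrite mulmxDr [u *m (c *m _)]mulmxA [u *m c]mx11_scalar mul_scalar_mx !mxE.
have ei0 : (e i) 0 j = 0 by rewrite mxE eqxx eq_sym (negPf ij).
have ej1 : (e j) 0 j = 1 by rewrite mxE !eqxx.
have W'j (u : 'rV_(neg_count (isolate_mx j A))) : (u *m W') 0 j = 0.
  by rewrite eW' mxE Wj add0r mxE ei0 mulr0.
have fjj : hform A (e j) (e j) = 0 by rewrite formj -rowE !mxE.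
rewrite -addn1; apply: (@negdef_leq _ _ _ (col_mx W' (e i - a *: e j))) => //.
apply: negdef_extend => //.
- move=> u u0; rewrite eW' !(hformDl, hformDr, hformZl, hformZr) !formi.
  rewrite [hform A _ (e i)]hformC // formi Wj ei0 !(conjC0, mulr0, addr0).
  exact: negW.
- rewrite -scaleN1r scalerA mulN1r.
  rewrite !(hformDl, hformDr, hformZl, hformZr) [hform A (e j) (e i)]hformC //.
  rewrite !formi ei0 ej1 fjj conjC0 conjC1 !(mulr0, addr0, add0r, mulr1).
  rewrite rmorphN /= !mulNr -opprD oppr_lt0 [_ * a]mulrC -normCK.
  by rewrite addr_gt0 ?exprn_gt0 ?normr_gt0.
move=> u; rewrite -scaleN1r scalerA mulN1r hformDr hformZr.
rewrite hformC // formi W'j conjC0 mulr0 conjC0 add0r formj eW'.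
have sE (b : C) (M : 'M[C]_1) : (b *: M) 0 0 = b * M 0 0 by rewrite mxE.
rewrite mulmxDl mxE -scalemxAl sE -[e i *m _]rowE.
rewrite [row _ _ _ _]mxE [col _ _ _ _]mxE -/a /c -scalemxAr sE.
by rewrite [u *m (W *m _)]mulmxA mulrAC mulNr mulVf // mulN1r subrr mulr0.
Qed.
End Inertia.

(** * Cyclomatic number and cycles of a relation *)

Section RelGraph.
Variable V : finType.
Implicit Types (e : rel V) (c : seq V) (X K : {set V}) (M N : {set {set V}}).

Definition rel_edges e : {set {set V}} :=
  [set [set p.1; p.2] | p in [set p : V * V | e p.1 p.2]].

Definition cyc_rank e : int :=
  #|rel_edges e|%:Z - #|V|%:Z + (n_comp e predT)%:Z.

Definition rmatching e M := (M \subset rel_edges e) && trivIset M.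

Definition max_matching e : nat := \max_(M | rmatching e M) #|M|.

Definition rcycle e c := (2 < size c)%N && ucycleb e c.

Definition cedges c : {set {set V}} := [set [set x; next c x] | x in c].

Definition remove_edge a b e : rel V :=
  fun x y => e x y && ([set x; y] != [set a; b]).

(* Vertex deletion is modelled by isolating vertices: isolated vertices affect *)
(* none of n, m and c, and the vertex type stays fixed.                        *)
Definition isolate X e : rel V :=
  fun x y => [&& x \notin X, y \notin X & e x y].

Lemma eq_set2 (a b x y : V) : ([set x; y] == [set a; b]) =
  (x == a) && (y == b) || (x == b) && (y == a).
Proof.
apply/eqP/idP => [E|/orP[] /andP[/eqP-> /eqP->] //]; last exact: setUC.
have := set21 x y; have := set22 x y; have := set21 a b; have := set22 a b.
rewrite -{1 2}E {3 4}E !inE !(eq_sym a) !(eq_sym b).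
by do 4![case: eqP => //= _].
Qed.

Lemma edgeP e (E : {set V}) :
  reflect (exists x y, e x y /\ E = [set x; y]) (E \in rel_edges e).
Proof.
apply: (iffP imsetP) => [[[x y]]|[x [y [exy ->]]]].
  by rewrite inE /= => exy ->; exists x, y.
by exists (x, y); rewrite ?inE.
Qed.

Lemma mem_edge e x y : symmetric e -> ([set x; y] \in rel_edges e) = e x y.
Proof.
move=> es; apply/edgeP/idP => [[a [b [eab /eqP]]]|exy]; last by exists x, y.
by rewrite eq_set2 => /orP[] /andP[/eqP-> /eqP->]; rewrite // es.
Qed.

Lemma card_edge e (E : {set V}) : irreflexive e -> E \in rel_edges e -> #|E| = 2.
Proof.
move=> ei /edgeP[x [y [exy ->]]]; rewrite cards2.
by case: eqP exy => // ->; rewrite ei.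
Qed.

Lemma sub_edges e e' : subrel e' e -> rel_edges e' \subset rel_edges e.
Proof.
move=> sub; apply/subsetP => E /edgeP[x [y [/sub exy ->]]].
by apply/edgeP; exists x, y.
Qed.

Lemma remove_edge_sym a b e : symmetric e -> symmetric (remove_edge a b e).
Proof. by move=> es x y; rewrite /remove_edge es [[set x; y]]setUC. Qed.

Lemma remove_edge_sub a b e : subrel (remove_edge a b e) e.
Proof. by move=> x y /andP[]. Qed.

Lemma remove_edgeC a b e : remove_edge a b e =2 remove_edge b a e.
Proof. by move=> x y; rewrite /remove_edge [[set a; b]]setUC. Qed.

Lemma isolate_sym X e : symmetric e -> symmetric (isolate X e).
Proof. move=> es x y; rewrite /isolate es; by case: (x \in X); case: (y \in X). Qed.

Lemma isolate_sub X e : subrel (isolate X e) e.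
Proof. by move=> x y /and3P[]. Qed.

Lemma sub_irrefl e e' : subrel e' e -> irreflexive e -> irreflexive e'.
Proof. by move=> sub ei x; apply/negbTE; apply: contraFN (ei x); apply: sub. Qed.

Lemma sub_connect0 e e' : subrel e' e -> subrel (connect e') (connect e).
Proof. by move=> sub; apply: connect_sub => x y /sub; apply: connect1. Qed.

Lemma remove_edgesE a b e : symmetric e -> e a b ->
  rel_edges e = [set a; b] |: rel_edges (remove_edge a b e).
Proof.
move=> es eab; apply/setP => E; rewrite !inE.
apply/edgeP/orP => [[x [y [exy ->]]]|[/eqP ->|/edgeP[x [y [/andP[exy _] ->]]]]].
- have [->|ne] := eqVneq [set x; y] [set a; b]; first by left.
  by right; apply/edgeP; exists x, y; rewrite /remove_edge exy ne.
- by exists a, b.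
- by exists x, y.
Qed.

Lemma card_remove_edge a b e : symmetric e -> e a b ->
  #|rel_edges e| = #|rel_edges (remove_edge a b e)|.+1.
Proof.
move=> es eab; rewrite (remove_edgesE es eab) cardsU1; case: edgeP => //.
by case=> x [y [/andP[_ /negP ne] /eqP]]; rewrite eq_sym => /ne.
Qed.

Lemma connect_inv e (P : pred V) x y :
  (forall z w, P z -> e z w -> P w) -> P x -> connect e x y -> P y.
Proof.
move=> inv Px /connectP[p pth ->]; elim: p x Px pth => //= z p IH x Px.
by case/andP => exz; apply: IH; apply: inv exz.
Qed.

Lemma n_comp_remove a b e : symmetric e -> e a b ->
  n_comp (remove_edge a b e) predT =
  (n_comp e predT + ~~ connect (remove_edge a b e) a b)%N.
Proof.
move=> es eab; set e' := remove_edge a b e.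
have es' : symmetric e' by apply: remove_edge_sym.
have cs := sym_connect_sym es; have cs' := sym_connect_sym es'.
(* [S] is what [a] or [b] still reaches after the removal. It is one component of [e], and one or
   two components of [e']; outside it nothing changes. *)
pose S := [pred x | connect e' a x || connect e' b x].
have subc : subrel (connect e') (connect e) := sub_connect0 (@remove_edge_sub a b e).
have Sinv z w : S z -> e z w -> S w.
  move=> Sz ezw; have [/eqP|ne] := eqVneq [set z; w] [set a; b].
    by rewrite eq_set2 => /orP[] /andP[_ /eqP ->]; rewrite inE connect0 ?orbT.
  have ezw' : connect e' z w by apply: connect1; rewrite /e' /remove_edge ezw ne.
  by case/orP: Sz => /connect_trans/(_ ezw') h; rewrite inE h ?orbT.
have SinvC z w : ~~ S z -> e z w -> ~~ S w.
  by move=> Sz ezw; apply: contra Sz => Sw; apply: Sinv Sw _; rewrite es.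
have SC x y : ~~ S x -> connect e x y = connect e' x y.
  move=> Sx; apply/idP/idP => [|/subc //].
  move=> xy; have : ~~ S y && connect e' x y; last by case/andP.
  apply: (connect_inv (P := [pred y | ~~ S y && connect e' x y])) xy => /=.
    move=> z w /andP[Sz xz] ezw; rewrite (SinvC z) //=.
    apply: connect_trans xz (connect1 _); rewrite /e' /remove_edge ezw /=.
    apply: contra Sz; rewrite eq_set2 => /orP[] /andP[/eqP-> _];
    by rewrite connect0 ?orbT.
  by rewrite Sx connect0.
rewrite (n_compC S e') (n_compC S e) addnAC; congr (_ + _)%N.
  have -> : n_comp e S = 1%N.
    rewrite -(n_comp_connect cs a); apply: eq_n_comp_r => x; rewrite !inE.
    apply/orP/idP => [[/subc //|/subc]|].
      by apply: connect_trans; apply: connect1.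
    by move=> ax; apply/orP; apply: (connect_inv (P := S) Sinv _ ax); rewrite inE connect0.
  rewrite add1n -(n_comp_closure2 cs'); apply: eq_n_comp_r => x.
  have -> : (x \in closure e' (pred2 a b)) = ~~ [disjoint connect e' x & pred2 a b].
    by [].
  rewrite inE; apply/orP/pred0Pn => [|[y /andP[xy /orP[]/eqP yE]]].
  - by case=> h; [exists a | exists b];
      rewrite /= !inE eqxx ?orbT andbT cs'.
  - by left; rewrite cs' -yE.
  - by right; rewrite cs' -yE.
rewrite /n_comp_mem; apply: eq_card => x; rewrite !inE.
change (roots e' x && ~~ S x = roots e x && ~~ S x).
case: (boolP (S x)) => Sx; first by rewrite !andbF.
rewrite !andbT /roots /root; congr (_ == _); congr odflt; apply: eq_pick => y.
by rewrite -SC.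
Qed.

(** The loss of an edge is compensated by a new component exactly when the edge is a bridge. *)
Lemma cyc_remove a b e : symmetric e -> e a b ->
  cyc_rank e = cyc_rank (remove_edge a b e) + (connect (remove_edge a b e) a b)%:Z.
Proof.
move=> es eab; rewrite /cyc_rank n_comp_remove // (card_remove_edge es eab).
case: connect => /=; lia.
Qed.
End RelGraph.

Section RelGraph.
Variable V : finType.
Implicit Types (e : rel V) (c : seq V) (X K : {set V}) (M N : {set {set V}}).

Lemma eq_rel_fun e e' : e =2 e' -> e = e'.
Proof. by move=> E; apply: funext => x; apply: funext => y. Qed.

Lemma cyc_rank0 e : (forall x y, ~~ e x y) -> cyc_rank e = 0.
Proof.
move=> e0; rewrite /cyc_rank.
have -> : rel_edges e = set0.
  by apply/setP => E; rewrite inE; apply/edgeP => -[x [y [exy _]]]; have := e0 x y; rewrite exy.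
have -> : n_comp e predT = #|V|.
  rewrite /n_comp_mem; apply: eq_card => x; rewrite !inE andbT /roots.
  have /connectP[[|z p] /= pth ->] := connect_root e x; first exact: eqxx.
  by case/andP: pth; rewrite (negPf (e0 _ _)).
by rewrite cards0; lia.
Qed.

Lemma cyc_mono e e' : symmetric e -> symmetric e' -> subrel e' e ->
  cyc_rank e' <= cyc_rank e.
Proof.
move: {2}#|rel_edges e| (leqnn #|rel_edges e|) => n.
elim: n e => [|n IH] e.
  rewrite leqn0 cards_eq0 => /eqP E0 es es' sub.
  have e0 x y : ~~ e x y by rewrite -mem_edge // E0 inE.
  by rewrite !cyc_rank0 // => x y; apply: contra (e0 x y); apply: sub.
move=> le_n es es' sub.
have [/existsP[a /existsP[b /andP[eab ne'ab]]]|no] :=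
  boolP [exists a, exists b, e a b && ~~ e' a b].
  rewrite (cyc_remove es eab); apply: le_trans (IH (remove_edge a b e) _ _ es' _) _.
  - by rewrite -ltnS -(card_remove_edge es eab).
  - exact: remove_edge_sym.
  - move=> x y e'xy; rewrite /remove_edge sub //=; apply: contra ne'ab.
    by rewrite -!(mem_edge _ _ es') => /eqP <-; rewrite mem_edge.
  - by rewrite lerDl.
have -> // : e = e'.
apply: eq_rel_fun => x y; apply/idP/idP => [exy|/sub //].
by apply: contraNT no => ne; apply/existsP; exists x; apply/existsP; exists y; rewrite exy.
Qed.

Lemma cyc_rank_ge0 e : symmetric e -> 0 <= cyc_rank e.
Proof.
move=> es; have := @cyc_mono e (fun _ _ => false) es; rewrite (@cyc_rank0 (fun _ _ => false)) //.
by apply.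
Qed.

(** * Cycles, bridges and vertex deletion *)

Lemma rcycle_sub e e' c : subrel e e' -> rcycle e c -> rcycle e' c.
Proof.
move=> sub /andP[sz /andP[cy un]]; rewrite /rcycle sz /ucycleb un andbT.
exact: sub_cycle cy.
Qed.

Lemma rcycle_next e c x : rcycle e c -> x \in c -> e x (next c x).
Proof. by move=> /andP[_ /andP[cy _]] xc; apply: next_cycle. Qed.

Lemma rcycle_from_next e e' c : rcycle e c ->
  (forall x, x \in c -> e' x (next c x)) -> rcycle e' c.
Proof.
move=> /andP[sz /andP[cy un]] nx; rewrite /rcycle sz /ucycleb un andbT.
by apply: cycle_from_next.
Qed.

Lemma mem_cedges c x : x \in c -> [set x; next c x] \in cedges c.
Proof. by move=> xc; apply: imset_f. Qed.

Lemma cedges_sub e c : rcycle e c -> cedges c \subset rel_edges e.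
Proof.
move=> cc; apply/subsetP => E /imsetP[x xc ->]; apply/edgeP.
by exists x, (next c x); split=> //; apply: rcycle_next cc xc.
Qed.

Lemma cedges_mem c x (E : {set V}) : E \in cedges c -> x \in E -> x \in c.
Proof.
by case/imsetP => y yc ->; rewrite !inE => /orP[] /eqP -> //; rewrite mem_next.
Qed.

Lemma cedges_eq_mem c1 c2 : cedges c1 = cedges c2 -> {subset c1 <= c2}.
Proof.
by move=> E x /mem_cedges; rewrite E => /cedges_mem; apply; rewrite !inE eqxx.
Qed.

Lemma rcycle_isolate e c X : rcycle e c ->
  (forall x, x \in c -> x \notin X) -> rcycle (isolate X e) c.
Proof.
move=> cc cX; apply: rcycle_from_next (cc) _ => x xc.
by rewrite /isolate !cX ?mem_next // (rcycle_next cc).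
Qed.

Lemma rcycle_isolateP e c X : rcycle (isolate X e) c ->
  rcycle e c /\ forall x, x \in c -> x \notin X.
Proof.
move=> cc; split; first by apply: rcycle_sub cc; apply: isolate_sub.
by move=> x xc; have /andP[] := rcycle_next cc xc.
Qed.

Lemma rcycle_remove e c a b : rcycle e c -> [set a; b] \notin cedges c ->
  rcycle (remove_edge a b e) c.
Proof.
move=> cc abc; apply: rcycle_from_next (cc) _ => x xc.
rewrite /remove_edge (rcycle_next cc) //=; apply: contra abc => /eqP <-.
exact: mem_cedges.
Qed.

Lemma rcycle_connect e c x y : rcycle e c -> x \in c -> y \in c -> connect e x y.
Proof. by move=> /andP[_ /andP[cy _]]; apply: connect_cycle. Qed.

Lemma cycle_edge_connect e c x : symmetric e -> rcycle e c -> x \in c ->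
  connect (remove_edge x (next c x) e) x (next c x).
Proof.
move=> es /andP[sz /andP[cy un]] xc.
have [i p E] := rot_to xc.
rewrite -(next_rot i un) E.
have {cy} : cycle e (x :: p) by rewrite -E rot_cycle.
have {un} : uniq (x :: p) by rewrite -E rot_uniq.
have {sz} : (2 < size (x :: p))%N by rewrite -E size_rot.
case: p {E} => [|y [|z p]] //= _; rewrite eqxx.
rewrite !inE => /and4P[/norP[xy /norP[xz xp]] /norP[yz yp] zp _].
case/and3P => _ eyz pth; set e' := remove_edge x y e.
have e's : symmetric e' by apply: remove_edge_sym.
rewrite (sym_connect_sym e's).
(* The rest of the cycle leads back to [x]; no step of it starts at [x] or [y], so none uses the
   removed edge. *)
have step : forall (p : seq V) z, z != x -> z != y -> x \notin p -> y \notin p ->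
    path e z (rcons p x) -> connect e' z x.
  elim=> [|w q IH] t tx ty /=.
    move=> _ _; rewrite andbT => etx; apply: connect1; rewrite /e' /remove_edge etx.
    by rewrite eq_set2 (negPf tx) (negPf ty).
  rewrite !inE => /norP[xw xq] /norP[yw yq] /andP[etw pq].
  apply: connect_trans (IH w _ _ xq yq pq); rewrite 1?eq_sym //.
  apply: connect1; rewrite /e' /remove_edge etw.
  by rewrite eq_set2 (negPf tx) (negPf ty).
have zx : z != x by rewrite eq_sym.
have zy : z != y by rewrite eq_sym.
apply: connect_trans (step p z zx zy xp yp pth).
apply: connect1; rewrite /e' /remove_edge eyz eq_set2.
by rewrite (negPf zx) (negPf zy) !andbF.
Qed.

Lemma edge_cycle e a b : symmetric e -> irreflexive e -> e a b ->
  connect (remove_edge a b e) a b ->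
  exists c, rcycle e c /\ [set a; b] \in cedges c.
Proof.
move=> es ei eab; rewrite (sym_connect_sym (remove_edge_sym _ _ es)).
case/connectP => p0 pth0 aE0; case/shortenP: pth0 aE0 => p pth un _ aE.
have nab : a != b by apply: contraTneq eab => ->; rewrite ei.
have na : next (b :: p) a = b.
  rewrite next_nth aE mem_last index_last // nth_default //.
exists (b :: p); split; last first.
  by rewrite -{1}na; apply: mem_cedges; rewrite aE mem_last.
rewrite /rcycle /ucycleb un andbT; apply/andP; split.
  case: p pth un aE na {p0} => [|z [|//]] /=; first by move=> _ _ ab; rewrite ab eqxx in nab.
  by move=> /andP[/andP[_ /negP]] + _ _ zE; rewrite -zE setUC eqxx; case.
rewrite /= rcons_path -aE eab andbT.
by apply: sub_path pth; apply: remove_edge_sub.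
Qed.

Lemma cyc_isolate_mono e v : symmetric e ->
  cyc_rank (isolate [set v] e) <= cyc_rank e.
Proof. by move=> es; apply: cyc_mono (@isolate_sub _ _ _); rewrite //; apply: isolate_sym. Qed.

Lemma isolate_remove e v a : symmetric e ->
  isolate [set v] (remove_edge v a e) = isolate [set v] e.
Proof.
move=> es; apply: eq_rel_fun => x y; rewrite /isolate /remove_edge !inE eq_set2.
by case: (x =P v); case: (y =P v) => //= _ _; rewrite andbF andbT.
Qed.

Lemma cyc_isolate_cycle e c v : symmetric e -> rcycle e c -> v \in c ->
  cyc_rank (isolate [set v] e) + 1 <= cyc_rank e.
Proof.
move=> es cc vc; rewrite (cyc_remove es (rcycle_next cc vc)) cycle_edge_connect //.
rewrite -(isolate_remove v (next c v) es) lerD2r.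
by apply: cyc_isolate_mono; apply: remove_edge_sym.
Qed.

(** Removing the edge of [c1] at [v] costs one cycle and leaves [c2] intact; deleting [v] then
    destroys [c2] as well. *)
Lemma cyc_isolate_cycle2 e c1 c2 v : symmetric e -> rcycle e c1 -> rcycle e c2 ->
  v \in c1 -> v \in c2 -> [set v; next c1 v] \notin cedges c2 ->
  cyc_rank (isolate [set v] e) + 2 <= cyc_rank e.
Proof.
move=> es cc1 cc2 vc1 vc2 ne.
rewrite (cyc_remove es (rcycle_next cc1 vc1)) cycle_edge_connect //.
rewrite -(isolate_remove v (next c1 v) es) -[2]/(1 + 1) addrA lerD2r.
apply: cyc_isolate_cycle vc2; first exact: remove_edge_sym.
exact: rcycle_remove.
Qed.

(** Every edge at [v] is a bridge, so the edges can be removed one at a time without changing c. *)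
Lemma cyc_isolate_nocycle e v : symmetric e -> irreflexive e ->
  (forall c, rcycle e c -> v \notin c) ->
  cyc_rank (isolate [set v] e) = cyc_rank e.
Proof.
move: {2}#|rel_edges e| (leqnn #|rel_edges e|) => n.
elim: n e => [|n IH] e.
  rewrite leqn0 cards_eq0 => /eqP E0 es ei _.
  have e0 x y : ~~ e x y by rewrite -mem_edge // E0 inE.
  by rewrite !cyc_rank0 // => x y; apply: contra (e0 x y); apply: isolate_sub.
move=> le_n es ei nov.
have [/existsP[a eva]|no] := boolP [exists a, e v a]; last first.
  congr cyc_rank; apply: eq_rel_fun => x y; rewrite /isolate !inE.
  have nv z : ~~ e v z by apply: contra no => ?; apply/existsP; exists z.
  case: eqP => [->|_] /=; first by rewrite (negPf (nv _)).
  by case: eqP => [->|_] //=; rewrite es (negPf (nv _)).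
rewrite (cyc_remove es eva) -(isolate_remove v a es).
rewrite IH; first 1 last.
- by rewrite -ltnS -(card_remove_edge es eva).
- exact: remove_edge_sym.
- by apply: sub_irrefl ei; apply: remove_edge_sub.
- by move=> c cc; apply: nov; apply: rcycle_sub cc; apply: remove_edge_sub.
case: (boolP (connect _ _ _)) => [con|]; last by rewrite addr0.
have [c [cc /cedges_mem]] := edge_cycle es ei eva con.
by move=> /(_ v); rewrite !inE eqxx => /(_ isT); rewrite (negPf (nov _ cc)).
Qed.

(** * Vertex-disjoint cycles *)

Definition rdisjoint e := forall c1 c2, rcycle e c1 -> rcycle e c2 ->
  cedges c1 <> cedges c2 -> [disjoint c1 & c2].

Lemma rdisjoint_sub e e' : subrel e' e -> rdisjoint e -> rdisjoint e'.
Proof. by move=> sub d c1 c2 /(rcycle_sub sub) ? /(rcycle_sub sub) ?; apply: d. Qed.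

(** Walking round [c1] from the shared vertex, each step follows an edge of [c2], so the walk never
    leaves [c2]. *)
Lemma cycle_eq_walk e c1 c2 x : rcycle e c1 -> x \in c1 -> x \in c2 ->
  (forall v, v \in c1 -> v \in c2 -> [set v; next c1 v] \in cedges c2) ->
  cedges c1 \subset cedges c2.
Proof.
move=> cc1 x1 x2 H.
have sub y : y \in c1 -> y \in c2.
  move=> y1; pose e1 : rel V := fun z w => (z \in c1) && (w == next c1 z).
  have c1c : rcycle e1 c1 by apply: rcycle_from_next (cc1) _ => z z1; rewrite /e1 z1 eqxx.
  have := rcycle_connect c1c x1 y1.
  apply: (connect_inv (P := mem c2)) => // z w /= z2 /andP[z1 /eqP ->].
  by apply: cedges_mem (H z z1 z2) _; rewrite !inE eqxx orbT.
by apply/subsetP => E /imsetP[y y1 ->]; apply: H => //; apply: sub.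
Qed.

(** If at a common vertex one cycle went on by an edge outside the other, deleting that vertex would
    lower c by 2. Hence two cycles that meet follow each other all the way round. *)
Lemma rdisjoint_of_cyc e : symmetric e ->
  (forall v, cyc_rank e <= cyc_rank (isolate [set v] e) + 1) -> rdisjoint e.
Proof.
move=> es drop c1 c2 cc1 cc2 ne; apply/pred0P => x /=; apply/negbTE/negP.
case/andP => x1 x2; apply: ne.
have walk d1 d2 : rcycle e d1 -> rcycle e d2 ->
    forall v, v \in d1 -> v \in d2 -> [set v; next d1 v] \in cedges d2.
  move=> cd1 cd2 v v1 v2; apply/negPn/negP => nv.
  have := cyc_isolate_cycle2 es cd1 cd2 v1 v2 nv; have := drop v; lia.
apply/eqP; rewrite eqEsubset; apply/andP; split.
  by apply: cycle_eq_walk (cc1) x1 x2 _; apply: walk.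
by apply: cycle_eq_walk (cc2) x2 x1 _; apply: walk.
Qed.

Lemma rdisjoint_meet e c1 c2 x : rdisjoint e -> rcycle e c1 -> rcycle e c2 ->
  x \in c1 -> x \in c2 -> cedges c1 = cedges c2.
Proof.
move=> d cc1 cc2 x1 x2; apply/eqP/negPn/negP => /eqP ne.
by have /pred0P/(_ x)/= := d _ _ cc1 cc2 ne; rewrite x1 x2.
Qed.

(** A chord has its ends joined along [c], so it lies on a cycle that meets [c], and this cycle has
    the same edges as [c]. *)
Lemma chordless e c x y : symmetric e -> irreflexive e -> rdisjoint e ->
  rcycle e c -> x \in c -> y \in c -> e x y -> [set x; y] \in cedges c.
Proof.
move=> es ei d cc xc yc exy; apply/negPn/negP => ne.
have con := rcycle_connect (rcycle_remove cc ne) xc yc.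
have [c' [cc' xyc']] := edge_cycle es ei exy con.
have xc' : x \in c' by apply: cedges_mem xyc' _; rewrite !inE eqxx.
by rewrite (rdisjoint_meet d cc cc' xc xc') xyc' in ne.
Qed.

(** The side of an edge is the component of its first end once the edge is removed. A walk on the
    side of [a'] cannot cross the edge [a b], for it would visit [a]; so the sides are nested, and
    their size decreases in walks along bridges. *)
Lemma side_shrink e a b a' b' z : connect (remove_edge a b e) a a' ->
  ~~ connect (remove_edge a' b' e) a' a ->
  connect (remove_edge a' b' e) a' z -> connect (remove_edge a b e) a z.
Proof.
move=> aa' na az.
have : connect (remove_edge a b e) a z && connect (remove_edge a' b' e) a' z.
  apply: (connect_inv (P := fun z => connect (remove_edge a b e) a z &&
    connect (remove_edge a' b' e) a' z)) az; last by rewrite aa' connect0.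
  move=> t w /andP[at_ a't] tw.
  have a'w := connect_trans a't (connect1 tw).
  rewrite a'w andbT; apply: connect_trans at_ (connect1 _).
  case/andP: tw => etw _; rewrite /remove_edge etw eq_set2.
  apply/negP => /orP[] /andP[/eqP tE /eqP wE].
    by rewrite -tE a't in na.
  by rewrite -wE a'w in na.
by case/andP.
Qed.

Lemma side_proper e a b a' b' : connect (remove_edge a b e) a a' ->
  ~~ connect (remove_edge a' b' e) a' a ->
  (#|connect (remove_edge a' b' e) a'| < #|connect (remove_edge a b e) a|)%N.
Proof.
move=> aa' na; apply: proper_card; apply/properP; split.
  by apply/subsetP => z; apply: side_shrink.
by exists a; rewrite // -topredE /= connect0.
Qed.

(* Minimise the part of the graph hanging at [t] off the edge [t b], away from [S]. *)
Lemma no_pendant_cycle e (S : {set V}) x0 y0 : symmetric e -> irreflexive e ->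
  (forall x y, x \in S -> y \in S -> connect (isolate (~: S) e) x y) ->
  (forall x y, x \notin S -> e x y -> exists2 z, e x z & z != y) ->
  x0 \notin S -> e x0 y0 -> exists c t, [/\ rcycle e c, t \in c & t \notin S].
Proof.
move=> es ei Scon deg x0S ex0y0; apply: contrapT => nocyc.
have bridge t b : t \notin S -> e t b -> ~~ connect (remove_edge t b e) t b.
  move=> tS etb; apply/negP => /(edge_cycle es ei etb)[c [cc tbc]].
  apply: nocyc; exists c, t; split=> //.
  by apply: cedges_mem tbc _; rewrite !inE eqxx.
have Scon' t b x y : t \notin S -> x \in S -> y \in S ->
    connect (remove_edge t b e) x y.
  move=> tS xS yS; apply: sub_connect0 (Scon _ _ xS yS) => z w.
  rewrite /isolate !inE !negbK => /and3P[zS wS ezw]; rewrite /remove_edge ezw eq_set2.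
  by apply/negP => /orP[] /andP[/eqP E1 /eqP E2]; rewrite -?E1 -?E2 ?zS ?wS in tS.
have small n : forall t b, t \notin S -> e t b ->
    (forall s, s \in S -> ~~ connect (remove_edge t b e) t s) ->
    (#|connect (remove_edge t b e) t| <= n)%N -> False.
  elim: n => [|n IH] t b tS etb sideS.
    by rewrite leqn0 => /eqP /card0_eq /(_ t); rewrite -topredE /= connect0.
  move=> le_n; have [z etz zb] := deg _ _ tS etb.
  have tz : connect (remove_edge t b e) t z.
    apply: connect1; rewrite /remove_edge etz eq_set2 eqxx (negPf zb) /=.
    by apply: contraTN etb => /andP[/eqP <- _]; rewrite ei.
  have zS : z \notin S by apply/negP => /sideS; rewrite tz.
  have ezt : e z t by rewrite es.
  have nzt := bridge _ _ zS ezt.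
  apply: (IH z t) => //.
    by move=> s /sideS; apply: contra; apply: side_shrink tz nzt.
  by rewrite -ltnS; apply: leq_trans le_n; apply: side_proper.
(* One of the two sides of the bridge [x0 y0] misses [S]: since [S] is connected in itself, meeting
   both sides would join the ends. Start from that side. *)
have [/existsP[s /andP[sS xs]]|no] :=
  boolP [exists s, (s \in S) && connect (remove_edge x0 y0 e) x0 s]; last first.
  apply: (small _ x0 y0) (leqnn _) => // s sS.
  by apply: contra no => xs; apply/existsP; exists s; rewrite sS.
have nxy := bridge _ _ x0S ex0y0.
have cs := sym_connect_sym (remove_edge_sym x0 y0 es).
have y0S : y0 \notin S.
  by apply: contra nxy => yS; apply: connect_trans xs (Scon' _ _ _ _ _ _ _).
apply: (small _ y0 x0) (leqnn _) => //; first by rewrite es.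
move=> s' s'S; rewrite -(eq_rel_fun (@remove_edgeC _ x0 y0 e)).
apply: contra nxy => ys'; rewrite cs; apply: connect_trans ys' _.
by rewrite cs; apply: connect_trans xs _; apply: Scon'.
Qed.
End RelGraph.

(** * Matchings *)

Section Matching.
Variable V : finType.
Implicit Types (e : rel V) (c : seq V) (X K : {set V}) (M N : {set {set V}}).

Lemma max_matching_ge e M : rmatching e M -> (#|M| <= max_matching e)%N.
Proof. exact: (@leq_bigmax_cond _ (rmatching e) (fun M => #|M|)). Qed.

Lemma rmatching0 e : rmatching e set0.
Proof. by rewrite /rmatching sub0set; apply/trivIsetP => E1 E2; rewrite inE. Qed.

Lemma max_matching_exists e : exists2 M, rmatching e M & #|M| = max_matching e.
Proof.
have [|M mM E] := @eq_bigmax_cond _ (rmatching e) (fun M => #|M|).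
  by apply/card_gt0P; exists set0; apply: rmatching0.
by exists M.
Qed.

Lemma rmatching_sub e e' M : subrel e' e -> rmatching e' M -> rmatching e M.
Proof.
by move=> sub /andP[Me tM]; rewrite /rmatching tM (subset_trans Me) ?sub_edges.
Qed.

Lemma rmatchingS e M N : N \subset M -> rmatching e M -> rmatching e N.
Proof.
move=> sub /andP[Me tM]; rewrite /rmatching (subset_trans sub) //=.
by apply: trivIsetS tM.
Qed.

Lemma max_matching_mono e e' : subrel e' e -> (max_matching e' <= max_matching e)%N.
Proof.
by move=> sub; have [M /(rmatching_sub sub) mM <-] := max_matching_exists e'; apply: max_matching_ge.
Qed.

Lemma rmatching_meet e M (E F : {set V}) x : rmatching e M ->
  E \in M -> F \in M -> x \in E -> x \in F -> E = F.
Proof.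
move=> /andP[_ /trivIsetP tM] EM FM xE xF; apply/eqP/negPn/negP => ne.
by have /pred0P/(_ x)/= := tM _ _ EM FM ne; rewrite xE xF.
Qed.

Lemma rmatching_edge e M (E : {set V}) : rmatching e M -> E \in M ->
  exists x y, e x y /\ E = [set x; y].
Proof. by move=> /andP[/subsetP sub _] /sub /edgeP. Qed.

Lemma edge_isolate X e (E : {set V}) :
  (E \in rel_edges (isolate X e)) = (E \in rel_edges e) && [disjoint E & X].
Proof.
apply/edgeP/andP => [[x [y [/and3P[xX yX exy] ->]]]|[/edgeP[x [y [exy ->]]] d]].
  split; first by apply/edgeP; exists x, y.
  by rewrite disjoint_subset; apply/subsetP => z; rewrite !inE => /orP[] /eqP ->.
exists x, y; split=> //; rewrite /isolate exy.
by rewrite !(disjointFr d) ?inE ?eqxx ?orbT.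
Qed.

Lemma rmatching_isolateE X e M : rmatching e M ->
  (forall E, E \in M -> [disjoint E & X]) -> rmatching (isolate X e) M.
Proof.
move=> /andP[/subsetP sub tM] d; rewrite /rmatching tM andbT.
by apply/subsetP => E EM; rewrite edge_isolate sub ?d.
Qed.

Lemma rmatching_isolate X e M : rmatching e M ->
  rmatching (isolate X e) [set E in M | [disjoint E & X]].
Proof.
move=> mM; apply: rmatching_isolateE => [|E]; last by rewrite inE => /andP[].
by apply: rmatchingS mM; apply/subsetP => E; rewrite inE => /andP[].
Qed.

Lemma card_isolate1 v e M : rmatching e M ->
  (#|M| <= #|[set E in M | [disjoint E & [set v]]]|.+1)%N.
Proof.
move=> mM; set N := [set E in M | _].
have [/existsP[F /andP[FM vF]]|no] := boolP [exists F, (F \in M) && (v \in F)].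
  rewrite -[_.+1]add1n -(cards1 F); apply: leq_trans (leq_card_setU _ _).
  apply: subset_leq_card; apply/subsetP => E EM; rewrite !inE EM /=.
  have [vE|] := boolP (v \in E); first by rewrite (rmatching_meet mM EM FM vE vF) eqxx.
  by rewrite disjoint_sym disjoints1 => ->; rewrite orbT.
apply: leqW; apply: subset_leq_card; apply/subsetP => E EM; rewrite inE EM /=.
rewrite disjoint_sym disjoints1; apply: contra no => vE.
by apply/existsP; exists E; rewrite EM.
Qed.

Lemma max_matching_isolate v e : (max_matching e <= (max_matching (isolate [set v] e)).+1)%N.
Proof.
have [M mM <-] := max_matching_exists e.
by apply: leq_trans (card_isolate1 v mM) _; rewrite ltnS max_matching_ge ?rmatching_isolate.
Qed.

Lemma rmatchingU1 e M x y : e x y -> rmatching e M ->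
  x \notin cover M -> y \notin cover M ->
  rmatching e ([set x; y] |: M) /\ #|[set x; y] |: M| = #|M|.+1.
Proof.
move=> exy mM xM yM; have /andP[sub tM] := mM.
have dis F : F \in M -> [disjoint [set x; y] & F].
  move=> FM; rewrite disjoint_subset; apply/subsetP => z.
  rewrite !inE => /orP[] /eqP ->; [apply: contra xM | apply: contra yM];
  by move=> zF; apply/bigcupP; exists F.
split; last first.
  rewrite cardsU1; case: (boolP (_ \in M)) => // /dis /pred0P/(_ x).
  by rewrite /= !inE eqxx.
apply/andP; split.
  by rewrite subUset sub1set sub andbT; apply/edgeP; exists x, y.
apply/trivIsetP => E F; rewrite !inE.
case/orP=> [/eqP ->|EM] /orP[/eqP->|FM] ne; rewrite ?eqxx // in ne.
- exact: dis.
- by rewrite disjoint_sym dis.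
- exact: (trivIsetP tM).
Qed.

Lemma coverP M x : reflect (exists2 E, E \in M & x \in E) (x \in cover M).
Proof. exact: bigcupP. Qed.

Lemma cover_edge e M x : symmetric e -> rmatching e M -> x \in cover M ->
  exists2 y, e x y & [set x; y] \in M.
Proof.
move=> es mM /coverP[E EM]; have [a [b [eab E_ab]]] := rmatching_edge mM EM.
rewrite E_ab !inE => /orP[] /eqP ->; [exists b | exists a]; rewrite // -?E_ab //.
  by rewrite es.
by rewrite setUC -E_ab.
Qed.

Lemma max_matching_pendant e x y : symmetric e -> irreflexive e -> e x y ->
  (forall z, e x z -> z = y) -> ((max_matching (isolate [set y] e)).+1 <= max_matching e)%N.
Proof.
move=> es ei exy xz; have [M mM <-] := max_matching_exists (isolate [set y] e).
have es' := isolate_sym [set y] es.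
have xM : x \notin cover M.
  apply/negP => /(cover_edge es' mM)[z /and3P[_ zy /xz zE] _].
  by rewrite zE !inE eqxx in zy.
have yM : y \notin cover M.
  by apply/negP => /(cover_edge es' mM)[z /and3P[]]; rewrite !inE eqxx.
have [mM' <-] := rmatchingU1 exy (rmatching_sub (@isolate_sub _ _ _) mM) xM yM.
exact: max_matching_ge.
Qed.

Lemma card_cover_matching e M : irreflexive e -> rmatching e M ->
  #|cover M| = (#|M|).*2.
Proof.
move=> ei /andP[/subsetP sub /eqP <-].
rewrite (eq_bigr (fun=> 2)) => [|E /sub]; last exact: card_edge.
by rewrite sum_nat_const muln2.
Qed.

Lemma path_matching e p : uniq p -> sorted e p -> ~~ odd (size p) ->
  exists2 M, rmatching e M & cover M = [set x in p].
Proof.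
have [n] := ubnP (size p); elim: n p => // n IH [|x [|y p]] //= le_n un pth od.
  exists set0; first exact: rmatching0.
  by rewrite /cover big_set0; apply/setP => z; rewrite !inE.
move: un pth; rewrite !inE => /and3P[/norP[xy xp] yp un] /andP[exy pth].
rewrite negbK in od.
have sp : sorted e p by case: (p) pth => //= z q /andP[].
have [M mM cM] := IH p (ltnW le_n) un sp od.
have [||mM' _] := @rmatchingU1 e M x y exy mM; rewrite ?cM ?inE //.
exists ([set x; y] |: M) => //.
by rewrite /cover bigcup_setU big_set1 -/(cover M) cM; apply/setP => z; rewrite !inE orbA.
Qed.

(** Cutting the cycle at [u] leaves a path with an even number of vertices. *)
Lemma odd_cycle_matching e c u : rcycle e c -> odd (size c) -> u \in c ->
  exists2 M, rmatching e M & cover M = [set x in c] :\ u.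
Proof.
move=> /andP[_ /andP[cy un]] od uc; have [i p E] := rot_to uc.
have un' : uniq (u :: p) by rewrite -E rot_uniq.
have cy' : cycle e (u :: p) by rewrite -E rot_cycle.
have memE : c =i u :: p by move=> x; rewrite -E mem_rot.
have od' : ~~ odd (size p) by rewrite -(size_rot i) E /= in od.
case/andP: un' => up unp.
have [|M mM cM] := path_matching (e := e) unp _ od'.
  by move: cy'; rewrite /= rcons_path; case: (p) => //= z q /andP[/andP[]].
exists M => //; rewrite cM; apply/setP => x; rewrite !inE memE inE.
by case: eqP => //= ->; apply/negbTE.
Qed.

Lemma even_cycle_matching e c : rcycle e c -> ~~ odd (size c) ->
  exists2 M, rmatching e M & cover M = [set x in c].
Proof.
move=> /andP[_ /andP[cy un]] od; apply: path_matching => //.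
by case: (c) cy => //= x p; rewrite rcons_path => /andP[].
Qed.

Lemma cover_isolate e M X : rmatching (isolate X e) M -> [disjoint cover M & X].
Proof.
move=> /andP[/subsetP sub _]; apply/pred0P => x /=; apply/negbTE/negP.
case/andP => /coverP[E /sub]; rewrite edge_isolate => /andP[_ /pred0P/(_ x)/= d] xE xX.
by rewrite xE xX in d.
Qed.

Lemma card_cycle e c : rcycle e c -> #|[set x in c]| = size c.
Proof. by move=> /andP[_ /andP[_ un]]; rewrite cardsE; apply/card_uniqP. Qed.

(** * Forests and König's theorem *)

Definition acyclic e := forall x y, e x y -> ~~ connect (remove_edge x y e) x y.

Lemma acyclic_sub e e' : subrel e' e -> acyclic e -> acyclic e'.
Proof.
move=> sub ac x y /[dup] e'xy /sub /ac; apply: contra; apply: sub_connect0.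
by move=> z w /andP[/sub ezw ne]; rewrite /remove_edge ezw.
Qed.

Lemma acyclic_nocycle e c : symmetric e -> acyclic e -> ~~ rcycle e c.
Proof.
move=> es ac; apply/negP => cc; have /andP[sz _] := cc.
case: c sz cc => // x c _ cc; have xc : x \in x :: c by rewrite inE eqxx.
by have := ac _ _ (rcycle_next cc xc); rewrite cycle_edge_connect.
Qed.

Lemma nocycle_pendant e x0 y0 : symmetric e -> irreflexive e ->
  (forall c, ~~ rcycle e c) -> e x0 y0 ->
  exists x y, e x y /\ forall z, e x z -> z = y.
Proof.
move=> es ei ac exy0; apply: contrapT => no.
have [||||c [_ [cc _ _]]] := @no_pendant_cycle V e set0 x0 y0 es ei.
- by move=> x y; rewrite inE.
- move=> x y _ exy; apply: contrapT => nz; apply: no; exists x, y; split=> // z exz.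
  by apply/eqP/negPn/negP => ne; apply: nz; exists z.
- by rewrite inE.
- exact: exy0.
by have := ac c; rewrite cc.
Qed.

(** The neighbour of a pendant vertex joins the cover: it covers all its edges, and deleting it
    lowers the matching number by at least 1. *)
Lemma konig_forest e : symmetric e -> irreflexive e -> acyclic e ->
  exists2 K : {set V}, (#|K| <= max_matching e)%N &
    forall x y, e x y -> (x \in K) || (y \in K).
Proof.
have [n] := ubnP #|rel_edges e|; elim: n e => // n IH e le_n es ei ac.
have [/existsP[x0 /existsP[y0 exy0]]|no] := boolP [exists x, exists y, e x y]; last first.
  exists set0; first by rewrite cards0.
  by move=> x y exy; case/negP: no; apply/existsP; exists x; apply/existsP; exists y.
have [|x [y [exy xz]]] := nocycle_pendant es ei _ exy0.
  by move=> c; apply: acyclic_nocycle.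
have sub : subrel (isolate [set y] e) e by apply: isolate_sub.
have [||||K cK covK] := IH (isolate [set y] e).
- apply: leq_trans (proper_card _) _; last by rewrite -ltnS; apply: le_n.
  apply/properP; split; first exact: sub_edges.
  exists [set x; y]; first by rewrite mem_edge.
  by rewrite mem_edge /isolate ?inE ?eqxx ?andbF //; apply: isolate_sym.
- exact: isolate_sym.
- exact: sub_irrefl ei.
- exact: acyclic_sub ac.
exists (y |: K).
  apply: leq_trans (max_matching_pendant es ei exy xz); apply: leq_trans (leq_card_setU _ _) _.
  by rewrite cards1 add1n ltnS.
move=> a b eab; rewrite !inE; case: eqP => //= ay; case: eqP => /= b_y; rewrite ?orbT //.
by apply: covK; rewrite /isolate eab !inE; case: eqP ay; case: eqP b_y.
Qed.
End Matching.

(** A matching is carried over by [phi]. Injectivity is asked at ends of edges, so that a retraction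
    constant on isolated vertices qualifies. *)
Lemma max_matching_hom (V1 V2 : finType) (e1 : rel V1) (e2 : rel V2) (phi : V1 -> V2) :
  (forall x y, e1 x y -> e2 (phi x) (phi y)) ->
  (forall x y x' y', e1 x x' -> e1 y y' -> phi x = phi y -> x = y) ->
  symmetric e1 -> (max_matching e1 <= max_matching e2)%N.
Proof.
move=> hom inj es; have [M mM <-] := max_matching_exists e1.
have meet E F x y : E \in M -> F \in M -> x \in E -> y \in F -> phi x = phi y -> E = F.
  move=> EM FM xE yF pxy.
  have [|x' exx' _] := cover_edge es mM (x := x); first by apply/coverP; exists E.
  have [|y' eyy' _] := cover_edge es mM (x := y); first by apply/coverP; exists F.
  have xy := inj _ _ _ _ exx' eyy' pxy.
  by apply: (rmatching_meet mM EM FM xE); rewrite xy.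
have injM : {in M &, injective (fun E : {set V1} => phi @: E)}.
  move=> E F EM FM EF; have [x [y [_ Exy]]] := rmatching_edge mM EM.
  have xE : x \in E by rewrite Exy !inE eqxx.
  have : phi x \in phi @: F by rewrite -EF imset_f.
  by case/imsetP => z zF pxz; apply: meet EM FM xE zF pxz.
rewrite -(card_in_imset injM); apply: max_matching_ge; apply/andP; split.
  apply/subsetP => _ /imsetP[E EM ->]; have [x [y [exy ->]]] := rmatching_edge mM EM.
  by apply/edgeP; exists (phi x), (phi y); split; [apply: hom | rewrite imsetU1 imset_set1].
apply/trivIsetP => _ _ /imsetP[E EM ->] /imsetP[F FM ->] ne.
apply/pred0P => z /=; apply/negbTE/negP => /andP[/imsetP[x xE ->] /imsetP[y yF pxy]].
by case/eqP: ne; rewrite (meet _ _ _ _ EM FM xE yF pxy).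
Qed.

(** * Gain matrices of subgraphs *)

Section Gain.
Local Open Scope sesquilinear_scope.
Variables (C : numClosedFieldType) (G : gain_graph C).
Implicit Types (e : rel G) (c : seq G) (x y v : G).

Definition subgraph e := symmetric e /\ subrel e (@adj G).

Definition sub_adjacency e : 'M[C]_#|G| :=
  \matrix_(i, j) if e (enum_val i) (enum_val j)
                 then gain (enum_val i : G) (enum_val j) else 0.

Definition ninertia e : nat := neg_count (sub_adjacency e).

Lemma subgraph_adj : subgraph (@adj G).
Proof. by split; [apply: adj_sym|]. Qed.

Lemma subgraph_isolate X e : subgraph e -> subgraph (isolate X e).
Proof.
by move=> [es sub]; split=> [|x y /isolate_sub /sub]; [apply: isolate_sym|].
Qed.

Lemma subgraph_irrefl e : subgraph e -> irreflexive e.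
Proof. by move=> [_ sub]; apply: sub_irrefl sub (@adj_irrefl G). Qed.

Lemma gainC x y : adj x y -> gain y x = (gain x y)^*.
Proof.
move=> xy; rewrite (gain_inv (x := y)) 1?adj_sym // invC_norm gain_norm //.
by rewrite expr1n invr1 mul1r.
Qed.

Lemma gain_mul_conj x y : adj x y -> gain x y * (gain x y)^* = 1.
Proof. by move=> xy; rewrite -normCK gain_norm // expr1n. Qed.

Lemma gain_neq0 x y : adj x y -> gain x y != 0.
Proof. by move=> xy; rewrite -normr_eq0 gain_norm // oner_eq0. Qed.

Lemma sub_adjacency_herm e : subgraph e -> (sub_adjacency e) ^t* = sub_adjacency e.
Proof.
move=> [es sub]; apply/matrixP => i j; rewrite !mxE es.
by case: ifP => [/sub ij|_]; rewrite ?conjC0 // -gainC // adj_sym.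
Qed.

Lemma sub_adjacency_isolate v e :
  sub_adjacency (isolate [set v] e) = isolate_mx (enum_rank v) (sub_adjacency e).
Proof.
apply/matrixP => i j; rewrite !mxE /isolate !inE.
rewrite -![_ == enum_rank v](inj_eq enum_val_inj) !enum_rankK.
by case: eqP => //= _; case: eqP.
Qed.

Lemma ninertia_isolate_ge v e : subgraph e ->
  (ninertia e <= (ninertia (isolate [set v] e)).+1)%N.
Proof.
move=> se; rewrite /ninertia sub_adjacency_isolate.
exact/neg_count_isolate_ge/sub_adjacency_herm.
Qed.

Lemma ninertia_pendant x y e : subgraph e -> e x y -> (forall z, e x z -> z = y) ->
  ((ninertia (isolate [set y] e)).+1 <= ninertia e)%N.
Proof.
move=> se exy xz; rewrite /ninertia sub_adjacency_isolate.
have ei := subgraph_irrefl se.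
apply: (neg_count_pendant (i := enum_rank x)).
- exact: sub_adjacency_herm.
- by rewrite mxE !enum_rankK exy gain_neq0 //; apply: (proj2 se).
- by rewrite mxE !enum_rankK ei.
- by rewrite (inj_eq enum_rank_inj); apply: contraTneq exy => ->; rewrite ei.
move=> l ly; rewrite mxE enum_rankK; case: ifP => // /xz E.
by rewrite -E enum_valK eqxx in ly.
Qed.

Lemma ninertia0 e : (forall x y, ~~ e x y) -> ninertia e = 0%N.
Proof.
move=> e0; rewrite /ninertia.
have -> : sub_adjacency e = 0 by apply/matrixP => i j; rewrite !mxE (negPf (e0 _ _)).
have [|W] := @negdef_exists C _ (0 : 'M_#|G|) _ _ (leqnn _).
  by rewrite trmx0 map_mx0.
move: (neg_count _) W => [//|k] W /(_ (const_mx 1)).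
rewrite /hform mulmx0 mul0mx mxE ltxx => H.
suff /H : (const_mx 1 : 'rV[C]_k.+1) != 0 by [].
by apply/rV0Pn; exists ord0; rewrite mxE oner_neq0.
Qed.

(** The cycle is a whole component without chords. Going round in steps of two produces a vector [f]
    with [f u = 1] and [f A] equal to [lam] at [u] and 0 elsewhere; [lam] is negative exactly for
    Type D. *)
Lemma ninertia_odd_cycle e c : subgraph e -> rcycle e c -> odd (size c) ->
  (forall x y, x \in c -> e x y -> [set x; y] \in cedges c) ->
  exists2 u, u \in c &
    (typeD c -> ((ninertia (isolate [set u] e)).+1 <= ninertia e)%N) /\
    (~ typeD c -> (ninertia e <= ninertia (isolate [set u] e))%N).
Proof.
move=> se cc od clos; have [es sub] := se; have /andP[sz /andP[_ un]] := cc.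
case: c sz cc od un clos => // u p; set c := u :: p => sz cc od un clos.
set q := size c in sz od.
exists u; first by rewrite inE eqxx.
pose w t := nth u c t.
have w0 : w 0%N = u by [].
(* The default value of [nth] is [u], so the listing closes up at index [q]. *)
have wq : w q = u by rewrite /w nth_default.
have wc t : w t \in c.
  have [lt|ge] := ltnP t q; first exact: mem_nth.
  by rewrite /w nth_default // inE eqxx.
have wK t : (t < q)%N -> index (w t) c = t by move=> lt; rewrite index_uniq.
have nextw t : (t < q)%N -> next c (w t) = w t.+1.
  by move=> lt; rewrite next_nth wc -[LHS]/(nth u p (index (w t) c)) wK.
have w_inj s t : (s < q)%N -> (t < q)%N -> w s = w t -> s = t.
  by move=> ls lt /(congr1 (index^~ c)); rewrite !wK.
have ew t : (t < q)%N -> e (w t) (w t.+1).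
  by move=> lt; rewrite -nextw //; apply: (rcycle_next cc).
have aw t : (t < q)%N -> adj (w t) (w t.+1) by move=> /ew /sub.
have nbr t x : (t < q)%N -> e x (w t) ->
    x = w t.+1 \/ exists2 s, (s < q)%N & x = w s /\ w t = w s.+1.
  move=> lt; rewrite es => /(clos _ _ (wc t)) /imsetP[y yc /eqP].
  have ly : (index y c < q)%N by rewrite index_mem.
  have yE : y = w (index y c) by rewrite /w nth_index.
  rewrite eq_set2 => /orP[] /andP[/eqP wE /eqP xE].
    by left; rewrite xE -wE nextw.
  right; exists (index y c) => //; rewrite -yE; split=> //.
  by rewrite wE {1}yE nextw.
pose g t := gain (w t) (w t.+1).
(* Column [t+1] of [f A] vanishes when entries [t] and [t+2] cancel. Even indices are reached
   forwards from [w 0 = u], odd ones backwards from [w q = u], as [q] is odd; both start with value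
   1. *)
pose F t := if odd t then (-1) ^+ (q - t)./2 * \prod_(t <= i < q) (g i)^*
            else (-1) ^+ t./2 * \prod_(0 <= i < t) g i.
pose a x y := if e x y then gain x y else 0.
have F0 : F 0%N = 1 by rewrite /F /= big_geq // mulr1.
have Fq : F q = 1 by rewrite /F od subnn big_geq // mulr1.
pose f x := if x \in c then F (index x c) else 0.
have fw t : (t <= q)%N -> f (w t) = F t.
  rewrite leq_eqVlt => /orP[/eqP ->|lt]; last by rewrite /f wc wK.
  by rewrite Fq wq /f inE eqxx /= eqxx F0.
have rec t : (t.+2 <= q)%N -> F t * g t + F t.+2 * (g t.+1)^* = 0.
  move=> le; rewrite /F /=; case: (boolP (odd t)) => /= ot.
    have -> : ((q - t)./2 = (q - t.+2)./2.+1)%N by lia.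
    rewrite big_ltn ?(ltnW le) // big_ltn // exprS.
    set P := \prod_(_ <= i < q) _; set s := (-1) ^+ _.
    have -> : -1 * s * ((g t)^* * ((g t.+1)^* * P)) * g t =
      - (s * P * (g t.+1)^* * (g t * (g t)^*)) by ring.
    by rewrite gain_mul_conj ?aw ?(ltnW le) // mulr1 addrC subrr.
  rewrite !big_nat_recr //= exprS.
  set P := \prod_(_ <= i < t) _; set s := (-1) ^+ _.
  have -> : -1 * s * (P * g t * g t.+1) * (g t.+1)^* =
    - (s * P * g t * (g t.+1 * (g t.+1)^*)) by ring.
  by rewrite gain_mul_conj ?aw // mulr1 subrr.
pose lam := 2 * 'Re ((-1) ^+ (size c).-1./2 * cycle_gain c).
(* At [u] the two neighbours contribute (-1)^((q-1)/2) phi(C) and its conjugate. *)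
have lamE : F q.-1 * g q.-1 + F 1%N * (g 0%N)^* = lam.
  have gE : cycle_gain c = \prod_(0 <= i < q) g i.
    rewrite /cycle_gain (big_nth u) big_nat [RHS]big_nat.
    by apply: eq_bigr => i /andP[_ lt]; rewrite -/(w i) nextw.
  rewrite /lam ReE [RHS]mulrC divfK ?pnatr_eq0 // gE rmorphM rmorphXn rmorphN1 -/q.
  rewrite /F /= (_ : odd q.-1 = false); last by lia.
  rewrite subn1 -!mulrA; congr (_ * _ + _ * _).
    by rewrite -[q]/((size p).+1) [RHS]big_nat_recr.
  rewrite rmorph_prod [RHS]big_ltn; first exact: mulrC.
  by lia.
have sumE x1 x2 z : x1 != x2 -> (forall x, e x z -> x = x1 \/ x = x2) ->
    \sum_x f x * a x z = f x1 * a x1 z + f x2 * a x2 z.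
  move=> ne nb; rewrite (bigD1 x1) //= (bigD1 x2) 1?eq_sym //= big1 ?addr0 //.
  move=> x /andP[n1 n2]; rewrite /a; case: ifP => [/nb[] xE|_]; rewrite ?mulr0 //.
    by rewrite xE eqxx in n1.
  by rewrite xE eqxx in n2.
have awS t : (t < q)%N -> a (w t) (w t.+1) = g t by move=> lt; rewrite /a ew.
have aSw t : (t < q)%N -> a (w t.+1) (w t) = (g t)^*.
  by move=> lt; rewrite /a es ew // -gainC ?aw.
have colE z : \sum_x f x * a x z = lam *+ (z == u).
  have [zc|zc] := boolP (z \in c); last first.
    have -> : (z == u) = false by apply: contraNF zc => /eqP ->; rewrite inE eqxx.
    apply: big1 => x _; rewrite /a; case: ifP => [exz|]; rewrite ?mulr0 // /f.
    case: ifP => [xc|]; rewrite ?mul0r //; case/negP: zc.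
    by apply: cedges_mem (clos _ _ xc exz) _; rewrite !inE eqxx orbT.
  have -> : z = w (index z c) by rewrite /w nth_index.
  have : (index z c < q)%N by rewrite index_mem.
  move: (index z c) => [|t] lt.
    rewrite w0 eqxx mulr1n -lamE (sumE (w q.-1) (w 1%N)).
    - rewrite (fw _ (leq_pred q)) (fw _ lt).
      have -> : a (w 1%N) u = (g 0%N)^* by apply: (aSw 0%N lt).
      have /awS : (q.-1 < q)%N by rewrite prednK.
      by rewrite prednK // wq => ->.
    - by apply/eqP => /w_inj H; have := H _ _; lia.
    - move=> x; rewrite -w0 => /(nbr _ _ lt)[->|[s ls [-> w0s]]]; first by right.
      left; have [ls'|] := ltnP s.+1 q; first by have := w_inj _ _ lt ls' w0s.
      by move=> ge; congr w; lia.
  have -> : (w t.+1 == u) = false.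
    by apply/negbTE/eqP => /(w_inj _ 0%N lt (ltn_trans _ lt)) H; have := H isT.
  have lt' := ltnW lt; rewrite mulr0n (sumE (w t) (w t.+2)).
  - by rewrite (fw _ (ltnW lt')) (fw _ lt) awS // aSw // rec.
  - apply/eqP => E; have [lt2|] := ltnP t.+2 q.
      by have := w_inj _ _ lt' lt2 E; lia.
    move=> ge; have tE : t.+2 = q by lia.
    by rewrite tE wq in E; have := w_inj t 0%N lt' (ltn_trans _ lt) E; lia.
  - move=> x /(nbr _ _ lt)[->|[s ls [-> ts]]]; first by right.
    left; congr w; have [ls'|ge] := ltnP s.+1 q.
      by have := w_inj _ _ lt ls' ts; lia.
    have sE : s.+1 = q by lia.
    by rewrite sE wq in ts; have := w_inj t.+1 0%N lt (ltn_trans _ lt) ts; lia.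
pose fv : 'rV[C]_#|G| := \row_i f (enum_val i).
have fvu : fv 0 (enum_rank u) = 1 by rewrite mxE enum_rankK -w0 fw.
have fvA : fv *m sub_adjacency e = lam *: delta_mx 0 (enum_rank u).
  apply/rowP => k; rewrite !mxE eqxx /=.
  have -> : (k == enum_rank u) = (enum_val k == u).
    by rewrite -(inj_eq enum_val_inj) enum_rankK.
  transitivity (lam *+ (enum_val k == u)); last by case: eqP; rewrite ?mulr1 ?mulr0.
  rewrite -colE (reindex_onto (@enum_rank G) enum_val) => [|i _]; last exact: enum_valK.
  rewrite (eq_bigl xpredT) => [|i]; last by rewrite enum_rankK eqxx.
  by apply: eq_bigr => x _; rewrite !mxE enum_rankK.
have AH := sub_adjacency_herm se.
rewrite /ninertia sub_adjacency_isolate; split=> [[_ neg]|ntD].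
  by apply: neg_count_eigvec_lt fvA _; rewrite // /lam pmulr_rlt0 ?ltr0n.
apply: neg_count_eigvec_ge fvA _ => //.
rewrite /lam pmulr_rge0 ?ltr0n // real_leNgt ?real0 ?Creal_Re //.
by apply/negP => neg; apply: ntD; split.
Qed.
End Gain.

(** * Tight subgraphs *)

Section Tight.
Variables (C : numClosedFieldType) (G : gain_graph C).
Implicit Types (e : rel G) (c : seq G) (x y v : G) (M N : {set {set G}}).

Definition tight e := (ninertia e)%:Z = (max_matching e)%:Z + cyc_rank e.

Lemma card_isolate_lt e x v : symmetric e -> e v x ->
  (#|rel_edges (isolate [set v] e)| < #|rel_edges e|)%N.
Proof.
move=> es evx; apply: proper_card; apply/properP; split.
  exact/sub_edges/isolate_sub.
exists [set v; x]; first by rewrite mem_edge.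
by rewrite mem_edge /isolate ?inE ?eqxx //; apply: isolate_sym.
Qed.

(** While a cycle exists, deleting one of its vertices pays for the drop of n with c; in a forest,
    deleting the neighbour of a pendant vertex pays for it with m. *)
Lemma ninertia_le e : subgraph e -> (ninertia e)%:Z <= (max_matching e)%:Z + cyc_rank e.
Proof.
have [n] := ubnP #|rel_edges e|; elim: n e => // n IH e le_n se; have [es sub] := se.
have IHv v x : e v x -> (ninertia (isolate [set v] e))%:Z <=
    (max_matching (isolate [set v] e))%:Z + cyc_rank (isolate [set v] e).
  move=> evx; apply: IH; last exact: subgraph_isolate.
  by apply: leq_trans (card_isolate_lt es evx) _.
have [[c cc]|noc] := pselect (exists c, rcycle e c).
  have [v vc] : exists v, v \in c.
    by have /andP[] := cc; case: (c) => // v p _ _; exists v; rewrite inE eqxx.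
  have := IHv _ _ (rcycle_next cc vc); have := cyc_isolate_cycle es cc vc.
  have := ninertia_isolate_ge v se; have := max_matching_mono (@isolate_sub _ [set v] e).
  lia.
have [/existsP[x0 /existsP[y0 exy0]]|no] := boolP [exists x, exists y, e x y].
  have [|x [y [exy xz]]] := nocycle_pendant es (subgraph_irrefl se) _ exy0.
    by move=> c; apply/negP => cc; apply: noc; exists c.
  have eyx : e y x by rewrite es.
  have := IHv _ _ eyx; have := cyc_isolate_mono y es.
  have := max_matching_pendant es (subgraph_irrefl se) exy xz.
  by have := ninertia_isolate_ge y se; lia.
rewrite ninertia0; first by have := cyc_rank_ge0 es; lia.
by move=> x y; apply: contra no => exy; apply/existsP; exists x; apply/existsP; exists y.
Qed.

Lemma tight_cycle e c v : subgraph e -> tight e -> rcycle e c -> v \in c ->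
  [/\ tight (isolate [set v] e), max_matching (isolate [set v] e) = max_matching e &
      ninertia e = (ninertia (isolate [set v] e)).+1].
Proof.
move=> se te cc vc; have [es sub] := se; rewrite /tight in te *.
have := ninertia_le (subgraph_isolate [set v] se).
have := cyc_isolate_cycle es cc vc; have := ninertia_isolate_ge v se.
have := max_matching_mono (@isolate_sub _ [set v] e); split; lia.
Qed.

(** n drops by at most 1 and m already drops by at least 1. If [y] were on a cycle, c would drop
    too, contradicting [ninertia_le] for the smaller graph. *)
Lemma tight_pendant e x y : subgraph e -> tight e -> e x y ->
  (forall z, e x z -> z = y) ->
  [/\ tight (isolate [set y] e), max_matching e = (max_matching (isolate [set y] e)).+1 &
      forall c, rcycle e c -> y \notin c].
Proof.
move=> se te exy xz; have [es sub] := se; rewrite /tight in te *.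
have := ninertia_le (subgraph_isolate [set y] se).
have := max_matching_pendant es (subgraph_irrefl se) exy xz.
have := ninertia_isolate_ge y se; have := cyc_isolate_mono y es.
split; [lia|lia|move=> c cc; apply/negP => yc].
by have := cyc_isolate_cycle es cc yc; lia.
Qed.

Lemma tight_rdisjoint e : subgraph e -> tight e -> rdisjoint e.
Proof.
move=> se te; have [es sub] := se; apply: rdisjoint_of_cyc => // v.
rewrite /tight in te; have := ninertia_le (subgraph_isolate [set v] se).
have := ninertia_isolate_ge v se; have := max_matching_mono (@isolate_sub _ [set v] e).
lia.
Qed.

(** Deleting a cycle vertex from a tight graph keeps m, so a maximum matching of the smaller graph
    is still maximum and misses that vertex. *)
Lemma tight_matching e : subgraph e -> tight e ->
  exists M, [/\ rmatching e M, #|M| = max_matching e &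
    forall c, rcycle e c -> exists2 v, v \in c & v \notin cover M].
Proof.
have [n] := ubnP #|rel_edges e|; elim: n e => // n IH e le_n se te; have [es sub] := se.
have [[c cc]|noc] := pselect (exists c, rcycle e c); last first.
  have [M mM cM] := max_matching_exists e; exists M; split=> // c cc.
  by case: noc; exists c.
have [v vc] : exists v, v \in c.
  by have /andP[] := cc; case: (c) => // v p _ _; exists v; rewrite inE eqxx.
have [te' mE _] := tight_cycle se te cc vc.
have [|M [mM cM unc]] := IH _ _ (subgraph_isolate [set v] se) te'.
  by apply: leq_trans (card_isolate_lt es (rcycle_next cc vc)) _.
exists M; split; [|by rewrite cM|].
  by apply: rmatching_sub mM; apply: isolate_sub.
move=> d cd; have [vd|vd] := boolP (v \in d).
  exists v => //; have /pred0P/(_ v)/= := cover_isolate mM.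
  by rewrite !inE eqxx andbT => ->.
by apply: unc; apply: rcycle_isolate => // x xd; rewrite inE; apply: contraNneq vd => <-.
Qed.

Definition inner M c := [set E in M | E \subset [set x in c]].

(** An even cycle has a perfect matching, so deleting a vertex would lower m, against [tight_cycle].
    The cycle is therefore odd; tightness forces n to drop at [u], hence Type D, and a maximum
    matching has (q-1)/2 edges. *)
Lemma tight_cycle_component e c M : subgraph e -> tight e -> rcycle e c ->
  (forall x y, e x y -> [set x; y] \in cedges c) ->
  rmatching e M -> #|M| = max_matching e ->
  typeD c /\ (#|inner M c|.*2).+1 = size c.
Proof.
move=> se te cc inc mM cM; have [es sub] := se; have ei := subgraph_irrefl se.
have covc N : rmatching e N -> cover N \subset [set x in c].
  move=> mN; apply/subsetP => x /(cover_edge es mN)[y exy _].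
  by rewrite inE; apply: cedges_mem (inc _ _ exy) _; rewrite !inE eqxx.
have szM := subset_leq_card (covc _ mM).
rewrite (card_cover_matching ei mM) (card_cycle cc) in szM.
have od : odd (size c).
  apply/negPn/negP => ev; have [N mN cN] := even_cycle_matching cc ev.
  have szN := card_cover_matching ei mN; rewrite cN (card_cycle cc) in szN.
  have [u uc] : exists u, u \in c.
    by have /andP[] := cc; case: (c) => // v p _ _; exists v; rewrite inE eqxx.
  have [_ mE _] := tight_cycle se te cc uc.
  have [N' mN' cN'] := max_matching_exists (isolate [set u] e).
  have mN'e := rmatching_sub (@isolate_sub _ _ _) mN'.
  have := card_cover_matching ei mN'e.
  have : (#|cover N'| < #|[set x in c]|)%N.
    apply: proper_card; apply/properP; split; first exact: covc.
    exists u; rewrite ?inE //; have /pred0P/(_ u)/= := cover_isolate mN'.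
    by rewrite !inE eqxx andbT => ->.
  rewrite (card_cycle cc); have := max_matching_ge mN; lia.
have clos x y : x \in c -> e x y -> [set x; y] \in cedges c by move=> _; apply: inc.
have [u uc [_ H]] := ninertia_odd_cycle se cc od clos.
have [_ _ nE] := tight_cycle se te cc uc.
split; first by apply: contrapT => /H; rewrite nE ltnn.
have -> : inner M c = M.
  apply/setP => E; rewrite inE; case: (boolP (E \in M)) => //= EM.
  by apply: subset_trans (covc _ mM); apply: bigcup_sup EM.
have [N mN cN] := odd_cycle_matching cc od uc.
have szN := card_cover_matching ei mN.
rewrite cN cardsDS ?sub1set ?inE // cards1 (card_cycle cc) in szN.
have := max_matching_ge mN; rewrite -cM.
by move: szM szN od; case: (size c) => // m; lia.
Qed.

(** The graph is stripped down to [c] while [M] stays maximum. The other cycles are broken at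
    vertices missed by [M], so [M] survives those deletions. *)
Lemma tight_cycle_typeD e c M : subgraph e -> tight e -> rcycle e c ->
  rmatching e M -> #|M| = max_matching e ->
  (forall d, rcycle e d -> cedges d <> cedges c -> exists2 v, v \in d & v \notin cover M) ->
  typeD c /\ (#|inner M c|.*2).+1 = size c.
Proof.
have [n] := ubnP #|rel_edges e|.
elim: n e M => // n IH e M le_n se te cc mM cM unc; have [es sub] := se.
have ei := subgraph_irrefl se; have dj := tight_rdisjoint se te.
have [[d [cd [v [vd vc]]]]|noout] :=
    pselect (exists d, rcycle e d /\ exists v, v \in d /\ v \notin c).
  have ne : cedges d <> cedges c.
    by move=> E; case/negP: vc; apply: cedges_eq_mem E _ vd.
  have [w wd wM] := unc _ cd ne; have /pred0P dis := dj _ _ cd cc ne.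
  have wc : w \notin c by apply/negP => wc; have := dis w; rewrite /= wd wc.
  have [te' mE _] := tight_cycle se te cd wd.
  apply: (IH (isolate [set w] e)) => //.
  - by apply: leq_trans (card_isolate_lt es (rcycle_next cd wd)) _.
  - exact: subgraph_isolate.
  - by apply: rcycle_isolate => // x xc; rewrite inE; apply: contraNneq wc => <-.
  - apply: rmatching_isolateE => // E EM; rewrite disjoint_sym disjoints1.
    by apply: contra wM => wE; apply/coverP; exists E.
  - by rewrite cM mE.
  - by move=> d' /rcycle_isolateP[cd' _]; apply: unc.
(* Here [M] loses at most one edge and m exactly one, so the remainder is maximum; [y] is on no
   cycle, so no edge inside [c] is lost. *)
have [[x [y [exy xz]]]|nopend] :=
    pselect (exists x y, e x y /\ forall z, e x z -> z = y).
  have [te' mE noy] := tight_pendant se te exy xz.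
  have yc := noy _ cc.
  have eyx : e y x by rewrite es.
  set M' := [set E in M | [disjoint E & [set y]]].
  have mM' : rmatching (isolate [set y] e) M' := rmatching_isolate [set y] mM.
  have -> : inner M c = inner M' c.
    apply/setP => E; rewrite !inE; case: (boolP (E \in M)) => //= EM.
    case: (boolP (E \subset _)) => //= /subsetP Ec; rewrite ?andbF // andbT.
    by rewrite disjoint_sym disjoints1; symmetry; apply: contra yc => /Ec; rewrite inE.
  apply: (IH (isolate [set y] e)) => //.
  - by apply: leq_trans (card_isolate_lt es eyx) _.
  - exact: subgraph_isolate.
  - by apply: rcycle_isolate => // z zc; rewrite inE; apply: contraNneq yc => <-.
  - by have := max_matching_ge mM'; have := card_isolate1 y mM; rewrite -/M'; lia.
  move=> d /rcycle_isolateP[cd _] ne; have [v vd vM] := unc _ cd ne.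
  exists v => //; apply: contra vM => /coverP[E]; rewrite inE => /andP[EM _] vE.
  by apply/coverP; exists E.
(* Without pendant vertices, an edge at a vertex outside [c] would yield a cycle leaving [c]. *)
have allc x y : e x y -> x \in c.
  move=> exy; apply/negPn/negP => xc.
  have [||||d [t [cd td]]] := @no_pendant_cycle G e [set z in c] x y es ei.
  - move=> a b; rewrite !inE => ac bc; apply: rcycle_connect ac bc.
    by apply: rcycle_isolate => // z zc; rewrite !inE zc.
  - move=> a b _ eab; apply: contrapT => nz; apply: nopend; exists a, b; split=> // z eaz.
    by apply/eqP/negPn/negP => ne; apply: nz; exists z.
  - by rewrite inE.
  - exact: exy.
  by rewrite inE => tc; apply: noout; exists d; split=> //; exists t.
apply: (tight_cycle_component se te) => // x y exy.
by apply: (chordless es ei dj cc) => //; [apply: allc exy | apply: (allc _ x); rewrite es].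
Qed.
End Tight.

(** * The lower bound on the inertia *)

Section MatchingUnion.
Variable V : finType.
Implicit Types (e : rel V) (M N : {set {set V}}).

Lemma mem_cover M (E : {set V}) x : E \in M -> x \in E -> x \in cover M.
Proof. by move=> EM xE; apply/coverP; exists E. Qed.

Lemma rmatching_disjointU e M N : rmatching e M -> rmatching e N ->
  [disjoint cover M & cover N] ->
  rmatching e (M :|: N) /\ #|M :|: N| = (#|M| + #|N|)%N.
Proof.
move=> mM mN /pred0P dis.
have disE E F : E \in M -> F \in N -> [disjoint E & F].
  move=> EM FN; apply/pred0P => x /=; apply/negbTE/negP => /andP[xE xF].
  by have := dis x; rewrite /= (mem_cover EM xE) (mem_cover FN xF).
split.
  case/andP: mM mN => subM /trivIsetP tM /andP[subN /trivIsetP tN].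
  rewrite /rmatching subUset subM subN; apply/trivIsetP => E F; rewrite !inE.
  case/orP=> HE /orP[] HF ne; [exact: tM|exact: disE| |exact: tN].
  by rewrite disjoint_sym disE.
apply/eqP; rewrite (leq_card_setU M N); apply/pred0P => E /=.
apply/negbTE/negP => /andP[EM EN]; have [x [y [_ Exy]]] := rmatching_edge mM EM.
by have /pred0P/(_ x) := disE _ _ EM EN; rewrite /= Exy !inE eqxx.
Qed.

Lemma matching_transversal e N (K : {set V}) (x0 : V) : rmatching e N ->
  (forall E, E \in N -> exists2 x, x \in E & x \in K) ->
  exists2 g : {set V} -> V, {in N &, injective g} &
    forall E, E \in N -> g E \in E /\ g E \in K.
Proof.
move=> mN hit; pose g (E : {set V}) := odflt x0 [pick x in E :&: K].
have gP E : E \in N -> g E \in E /\ g E \in K.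
  move=> /hit[x xE xK]; rewrite /g; case: pickP => [y|/(_ x)]; rewrite !inE.
    by case/andP.
  by rewrite xE xK.
exists g => // E F EN FN gEF; have [gE _] := gP _ EN; have [gF _] := gP _ FN.
by apply: (rmatching_meet mN EN FN gE); rewrite gEF.
Qed.

Lemma card_hitting e N (K : {set V}) : rmatching e N ->
  (forall E, E \in N -> exists2 x, x \in E & x \in K) -> (#|N| <= #|K|)%N.
Proof.
move=> mN hit; have [->|/set0Pn[E0 /hit[x0 _ _]]] := eqVneq N set0.
  by rewrite cards0.
have [g gI gP] := matching_transversal x0 mN hit.
rewrite -(card_in_imset gI); apply/subset_leq_card/subsetP => _ /imsetP[E /gP[_ gK] ->].
exact: gK.
Qed.

Lemma cover_subset M N : M \subset N -> cover M \subset cover N.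
Proof.
move=> /subsetP sub; apply/subsetP => x /coverP[E /sub EN xE].
exact: mem_cover EN xE.
Qed.

Lemma edge_on_cycle_acyclic e : symmetric e -> irreflexive e ->
  (forall c, ~~ rcycle e c) -> acyclic e.
Proof.
move=> es ei noc x y exy; apply/negP => /(edge_cycle es ei exy)[c [cc _]].
by have := noc c; rewrite cc.
Qed.
End MatchingUnion.

Section LowerBound.
Variables (C : numClosedFieldType) (G : gain_graph C).
Implicit Types (e : rel G) (c : seq G) (x y v : G) (K : {set G}) (M N : {set {set G}}).

(** Picking a vertex of [K] in each edge of [N] is injective, hence onto [K] by the cardinality
    bound; so every edge of [N] meets [K] exactly once. *)
Lemma cover_partner e K N : subgraph e -> rmatching e N ->
  (forall E, E \in N -> exists2 x, x \in E & x \in K) -> (#|K| <= #|N|)%N ->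
  forall k, k \in K -> exists l, [/\ e l k, l \notin K & [set l; k] \in N].
Proof.
move=> [es sub] mN hit le k0 k0K.
have [g gI gP] := matching_transversal k0 mN hit.
have gK : g @: N = K.
  apply/eqP; rewrite eqEcard card_in_imset // le andbT.
  by apply/subsetP => _ /imsetP[E /gP[_ gEK] ->].
have gE E k : E \in N -> k \in E -> k \in K -> k = g E.
  move=> EN kE; rewrite -gK => /imsetP[F FN kF]; rewrite kF; congr g.
  by apply: (rmatching_meet mN FN EN _ kE); rewrite kF; case: (gP _ FN).
have /imsetP[E EN kE] : k0 \in g @: N by rewrite gK.
have k0E : k0 \in E by rewrite kE; case: (gP _ EN).
have [a [b [eab Eab]]] := rmatching_edge mN EN.
have [l elk0 El] : exists2 l, e l k0 & E = [set l; k0].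
  move: k0E; rewrite Eab !inE => /orP[] /eqP ->; [exists b | exists a] => //.
    by rewrite es.
  by rewrite setUC.
exists l; split=> //; last by rewrite -El.
apply/negP => lK; have lE : l \in E by rewrite El !inE eqxx.
have lk : l = k0 by rewrite (gE _ _ EN lE lK).
by have := subgraph_irrefl (conj es sub) k0; rewrite -{1}lk elk0.
Qed.

(** Follow an alternating walk: if the partner [l] of [k] has another neighbour [k'], then [k'] is
    in [K], and the walk moves on to the partner of [k']. Edges of [N] are bridges, so the side of
    [l] shrinks until [l] is pendant. *)
Lemma cover_pendant e K N : subgraph e -> rmatching e N ->
  (forall c x, rcycle e c -> x \in c -> x \notin cover N) ->
  (forall x y, e x y -> [|| x \in K, y \in K |
     `[< exists2 c, rcycle e c & [set x; y] \in cedges c >]]) ->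
  (#|K| <= #|N|)%N -> K != set0 ->
  exists k l, [/\ k \in K, e l k & forall z, e l z -> z = k].
Proof.
move=> se mN Noff cov le /set0Pn[k0 k0K]; have [es sub] := se.
have ei := subgraph_irrefl se.
have hit E : E \in N -> exists2 x, x \in E & x \in K.
  move=> EN; have [x [y [exy Exy]]] := rmatching_edge mN EN.
  have [xE yE] : x \in E /\ y \in E by rewrite Exy !inE !eqxx orbT.
  case/or3P: (cov _ _ exy) => [xK|yK|/asboolP[c cc /cedges_mem xc]].
  - by exists x.
  - by exists y.
  - have {}xc := xc x (set21 _ _).
    by have := Noff _ _ cc xc; rewrite (mem_cover EN xE).
have partner := cover_partner se mN hit le.
have small n : forall k l, k \in K -> l \notin K -> [set l; k] \in N -> e l k ->
    (#|connect (remove_edge l k e) l| <= n)%N ->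
    exists k l, [/\ k \in K, e l k & forall z, e l z -> z = k].
  elim: n => [|n IH] k l kK lK lkN elk.
    by rewrite leqn0 => /eqP /card0_eq /(_ l); rewrite -topredE /= connect0.
  move=> le_n.
  have [pend|npend] := pselect (forall z, e l z -> z = k); first by exists k, l.
  have [k' [elk' k'k]] : exists k', e l k' /\ k' != k.
    apply: contrapT => no; apply: npend => z elz; apply/eqP/negPn/negP => ne.
    by apply: no; exists z.
  have lN : l \in cover N by apply: mem_cover lkN _; rewrite !inE eqxx.
  have k'K : k' \in K.
    case/or3P: (cov _ _ elk') => // [lK'|/asboolP[c cc /cedges_mem lc]].
      by rewrite lK' in lK.
    by have := Noff _ _ cc (lc _ (set21 _ _)); rewrite lN.
  have [l' [el'k' l'K l'N]] := partner _ k'K.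
  have kl z : z \in K -> (z == l) = false by move=> zK; apply: contraNF lK => /eqP <-.
  have l'l : l != l'.
    apply: contraTneq isT => E; rewrite -E in l'N.
    have := rmatching_meet mN l'N lkN (set21 _ _) (set21 _ _).
    by move=> /eqP; rewrite eq_set2 eqxx (negPf k'k) /= (kl _ k'K) andbF.
  have brd : ~~ connect (remove_edge l' k' e) l' k'.
    apply/negP => /(edge_cycle es ei el'k')[c [cc /cedges_mem l'c]].
    by have := Noff _ _ cc (l'c _ (set21 _ _)); rewrite (mem_cover l'N) // !inE eqxx.
  apply: (IH k' l') => //; rewrite -ltnS; apply: leq_trans le_n; apply: side_proper.
    apply: connect_trans (connect1 (y := k') _) (connect1 _).
      by rewrite /remove_edge elk' eq_set2 eqxx (negPf k'k) (kl _ k'K) !andbF.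
    by rewrite /remove_edge es el'k' eq_set2 (negPf k'k) (kl _ k'K).
  apply: contra brd => l'l_con; apply: connect_trans l'l_con (connect1 _).
  rewrite /remove_edge elk' eq_set2 (negPf l'l) /= [l == k']eq_sym.
  by rewrite (kl _ k'K).
have [l [elk lK lN]] := partner _ k0K.
exact: small _ _ _ k0K lK lN elk (leqnn _).
Qed.

(** The edges of a maximum matching inside the component [c] can be exchanged for a near-perfect
    matching of [c] that misses [u]. *)
Lemma max_matching_odd_component e c u : subgraph e -> rcycle e c -> odd (size c) ->
  u \in c -> (forall x y, x \in c -> e x y -> y \in c) ->
  (max_matching e <= max_matching (isolate [set u] e))%N.
Proof.
move=> se cc od uc clos; have [es sub] := se; have ei := subgraph_irrefl se.
have [M mM <-] := max_matching_exists e; have [N mN cN] := odd_cycle_matching cc od uc.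
have subI : inner M c \subset M by apply/subsetP => E; rewrite inE => /andP[].
have mI := rmatchingS subI mM; have mO := rmatchingS (subsetDl M (inner M c)) mM.
have coverO x : x \in cover (M :\: inner M c) -> x \notin c.
  case/coverP => E; rewrite /inner !inE negb_and => /andP[+ EM] xE.
  rewrite EM /=; apply: contra => xc; apply/subsetP => y yE; rewrite inE.
  have [a [b [eab Eab]]] := rmatching_edge mM EM.
  move: xE yE; rewrite Eab !inE.
  case/orP=> /eqP xE /orP[] /eqP ->; rewrite -?xE //; apply: (clos x) => //.
    by rewrite xE.
  by rewrite xE es.
have [|mU cU] := rmatching_disjointU mO mN.
  apply/pred0P => x /=; apply/negbTE/negP => /andP[/coverO].
  by rewrite cN !inE => /negPf ->; rewrite andbF.
have szN := card_cover_matching ei mN.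
rewrite cN cardsDS ?sub1set ?inE // cards1 (card_cycle cc) in szN.
have szI : (#|cover (inner M c)| <= size c)%N.
  rewrite -(card_cycle cc); apply/subset_leq_card/subsetP => x /coverP[E].
  by case/setIdP => _ /subsetP; apply.
rewrite (card_cover_matching ei mI) in szI.
apply: (@leq_trans #|(M :\: inner M c) :|: N|).
  rewrite cU cardsDS //; move: szI szN od; have := subset_leq_card subI.
  by case: (size c) => // m; lia.
apply: max_matching_ge; apply: rmatching_isolateE => // E EU.
rewrite disjoint_sym disjoints1; apply/negP => uE.
have : u \in cover (M :\: inner M c :|: N) := mem_cover EU uE.
case/coverP => F; rewrite inE => /orP[] FU uF.
  by have := coverO _ (mem_cover FU uF); rewrite uc.
by have := mem_cover FU uF; rewrite cN !inE eqxx.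
Qed.

(** Once one cycle edge at [u] is removed, [u] lies on no cycle, and deleting it leaves c
    unchanged. *)
Lemma cyc_component e c u : symmetric e -> irreflexive e -> rdisjoint e ->
  rcycle e c -> u \in c -> cyc_rank e <= cyc_rank (isolate [set u] e) + 1.
Proof.
move=> es ei dj cc uc; have eu := rcycle_next cc uc.
rewrite (cyc_remove es eu) -(isolate_remove u (next c u) es).
rewrite [cyc_rank (isolate _ _)]cyc_isolate_nocycle.
- by rewrite lerD2l; case: connect.
- exact: remove_edge_sym.
- by apply: sub_irrefl ei; apply: remove_edge_sub.
move=> d cd; apply/negP => ud.
have E := rdisjoint_meet dj (rcycle_sub (@remove_edge_sub _ _ _ _) cd) cc ud uc.
have := subsetP (cedges_sub cd) [set u; next c u].
rewrite E mem_cedges // mem_edge; last exact: remove_edge_sym.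
by rewrite /remove_edge eqxx andbF => /(_ isT).
Qed.

(** Induction on the edges. [K] covers the edges outside the cycles, and [N] certifies that [K] is
    small enough for a pendant vertex next to [K] to exist whenever [K] is nonempty. *)
Lemma lower_bound e K N : subgraph e -> rdisjoint e ->
  (forall c, rcycle e c -> typeD c) ->
  (forall c x, rcycle e c -> x \in c -> x \notin K) ->
  (forall x y, e x y -> [|| x \in K, y \in K |
     `[< exists2 c, rcycle e c & [set x; y] \in cedges c >]]) ->
  rmatching e N ->
  (forall c x, rcycle e c -> x \in c -> x \notin cover N) ->
  (#|K| <= #|N|)%N ->
  (max_matching e)%:Z + cyc_rank e <= (ninertia e)%:Z.
Proof.
have [n] := ubnP #|rel_edges e|.
elim: n e K N => // n IH e K N le_n se dj tD Koff cov mN Noff leKN.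
have [es sub] := se; have ei := subgraph_irrefl se.
have [K0|Kn0] := eqVneq K set0; last first.
  (* Deleting [k] lowers n by at least 1 and m by at most 1, and keeps c since [k] is on no
     cycle. *)
  have [k [l [kK elk pend]]] := cover_pendant se mN Noff cov leKN Kn0.
  have ekl : e k l by rewrite es.
  have mN' := rmatching_isolate [set k] mN.
  set N' := [set E in N | _] in mN'.
  have subN : N' \subset N by apply/subsetP => E; rewrite inE => /andP[].
  have cycE := cyc_isolate_nocycle es ei (v := k).
  have := ninertia_pendant se elk pend; have := max_matching_isolate k e.
  suff : (max_matching (isolate [set k] e))%:Z + cyc_rank (isolate [set k] e) <=
      (ninertia (isolate [set k] e))%:Z.
    rewrite cycE; first lia.
    by move=> c cc; apply/negP => /(Koff _ _ cc); rewrite kK.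
  apply: (IH _ (K :\ k) N') => //.
  - by apply: leq_trans (card_isolate_lt es ekl) _.
  - exact: subgraph_isolate.
  - by apply: rdisjoint_sub dj; apply: isolate_sub.
  - by move=> c /rcycle_isolateP[cc _]; apply: tD.
  - move=> c x /rcycle_isolateP[cc _] xc; rewrite !inE negb_and.
    by rewrite (Koff _ _ cc xc) orbT.
  - move=> x y /and3P[]; rewrite !inE => -> -> /cov /=.
    case/or3P => [->|->|/asboolP[c cc xyc]]; rewrite ?orbT //.
    apply/orP; right; apply/orP; right; apply/asboolP; exists c => //.
    apply: rcycle_isolate => // z zc; rewrite inE.
    by apply: contraTneq kK => <-; apply: Koff cc zc.
  - move=> c x /rcycle_isolateP[cc _] xc; apply: contra (Noff _ _ cc xc).
    exact/subsetP/cover_subset.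
  - by have := card_isolate1 k mN; rewrite -/N' (cardsD1 k) kK in leKN *; lia.
have [/existsP[x0 /existsP[y0 exy0]]|no] := boolP [exists x, exists y, e x y]; last first.
  have e0 x y : ~~ e x y.
    by apply: contra no => exy; apply/existsP; exists x; apply/existsP; exists y.
  rewrite cyc_rank0 //; have [M mM <-] := max_matching_exists e.
  have -> : M = set0.
    apply/setP => E; rewrite inE; apply/negP => /(rmatching_edge mM)[x [y [exy _]]].
    by have := e0 x y; rewrite exy.
  by rewrite cards0; lia.
have covc x y : e x y -> exists2 c, rcycle e c & [set x; y] \in cedges c.
  by move=> /cov; rewrite K0 !inE => /asboolP.
have [c cc xyc] := covc _ _ exy0; have [od _] := tD _ cc.
have clos x y : x \in c -> e x y -> [set x; y] \in cedges c.
  move=> xc /covc[d cd xyd].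
  by rewrite -(rdisjoint_meet dj cd cc (cedges_mem xyd (set21 _ _)) xc).
have closm x y : x \in c -> e x y -> y \in c.
  by move=> xc /(clos _ _ xc) /cedges_mem; apply; apply: set22.
(* With [K] empty, [c] is a Type D component: deleting [u] lowers n by at least 1, c by at most 1,
   and does not lower m. *)
have [u uc [nE _]] := ninertia_odd_cycle se cc od clos.
have {nE} := nE (tD _ cc).
have := max_matching_odd_component se cc od uc closm; have := cyc_component es ei dj cc uc.
suff : (max_matching (isolate [set u] e))%:Z + cyc_rank (isolate [set u] e) <=
    (ninertia (isolate [set u] e))%:Z by lia.
have off d x : rcycle (isolate [set u] e) d -> x \in d -> x \notin c.
  move=> /rcycle_isolateP[cd du] xd; apply/negP => xc.
  have E := rdisjoint_meet dj cd cc xd xc.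
  by have /du := cedges_eq_mem (esym E) uc; rewrite inE eqxx.
(* The rest of [c] becomes a path of edges on no cycle. [K] and [N] are renewed by a König cover of
   this path [r] and by the perfect matching of [c] minus [u]. *)
pose X := ~: [set x in c] :|: [set u]; set r := isolate X e.
have rs : symmetric r by apply: isolate_sym.
have ri : irreflexive r by apply: sub_irrefl ei; apply: isolate_sub.
have rac : acyclic r.
  apply: edge_on_cycle_acyclic => // d; apply/negP => cd.
  have [cd' dX] := rcycle_isolateP cd.
  have [x xd] : exists x, x \in d.
    by have /andP[] := cd; case: (d) => // x p _ _; exists x; rewrite inE eqxx.
  have := dX _ xd; rewrite !inE negb_or negbK => /andP[xc _].
  have E := rdisjoint_meet dj cd' cc xd xc.
  by have /dX := cedges_eq_mem (esym E) uc; rewrite !inE eqxx orbT.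
have [K1 leK1 covK1] := konig_forest rs ri rac.
have [N1 mN1 cN1] := odd_cycle_matching cc od uc.
have uN1 : u \notin cover N1 by rewrite cN1 !inE eqxx.
have dN1 E : E \in N1 -> [disjoint E & [set u]].
  move=> EN; rewrite disjoint_sym disjoints1; apply: contra uN1.
  exact: mem_cover EN.
apply: (IH _ (K1 :&: [set x in c]) N1).
- by apply: leq_trans (card_isolate_lt es (rcycle_next cc uc)) _.
- exact: subgraph_isolate.
- by apply: rdisjoint_sub dj; apply: isolate_sub.
- by move=> d /rcycle_isolateP[cd _]; apply: tD.
- by move=> d x cd xd; rewrite !inE (negPf (off _ _ cd xd)) andbF.
- move=> x y /and3P[xu yu exy]; rewrite !inE.
  have [xc|xc] := boolP (x \in c).
    rewrite (closm _ _ xc exy) !andbT orbA; apply/orP; left; apply: covK1.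
    rewrite /r /isolate /X !in_setU !in_setC (negPf xu) (negPf yu) !orbF !inE.
    by rewrite xc (closm _ _ xc exy).
  apply/orP; right; apply/orP; right; apply/asboolP.
  have [d cd xyd] := covc _ _ exy; exists d => //; apply: rcycle_isolate => // z zd.
  rewrite inE; apply: contraNneq xc => zu; rewrite zu in zd.
  have E := rdisjoint_meet dj cd cc zd uc.
  by apply: (cedges_eq_mem E); apply: cedges_mem xyd (set21 _ _).
- exact: rmatching_isolateE.
- by move=> d x cd xd; rewrite cN1 !inE (negPf (off _ _ cd xd)) andbF.
apply: leq_trans (subset_leq_card (subsetIl _ _)) _; apply: leq_trans leK1 _.
have [M mM <-] := max_matching_exists r; rewrite -leq_double.
rewrite -(card_cover_matching ri mM) -(card_cover_matching ei mN1).
apply/subset_leq_card/subsetP => x /(cover_edge rs mM)[y /and3P[xX _ _] _].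
by move: xX; rewrite cN1 !inE negb_or negbK andbC.
Qed.
End LowerBound.

(** * Contraction of the cycles *)

Section Contraction.
Variable G : sgraph.
Implicit Types (x y : G) (c : seq G) (X : {set G}) (M N : {set {set G}}).

Let A : rel G := @adj G.
Let O : {set G} := on_cycles G.
Let S : {set {set G}} := cycle_supports G.

Lemma cycle_supportP X :
  reflect (exists2 c, rcycle A c & X = [set x in c]) (X \in S).
Proof. by rewrite inE; apply: asboolP. Qed.

Lemma on_cyclesP x : reflect (exists2 c, rcycle A c & x \in c) (x \in O).
Proof.
apply: (iffP bigcupP) => [[X /cycle_supportP[c cc ->]]|[c cc xc]].
  by rewrite inE; exists c.
by exists [set z in c]; rewrite ?inE //; apply/asboolP; exists c.
Qed.

Lemma matching_number_delete : matching_number (delete O) = max_matching (isolate O A).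
Proof.
apply/eqP; rewrite eqn_leq; apply/andP; split.
  apply: (@max_matching_hom (delete O) G (@adj (delete O)) _ val).
  - by move=> x y xy; rewrite /isolate (valP x) (valP y).
  - by move=> x y _ _ _ _; apply: val_inj.
  - exact: adj_sym.
have [/existsP[x0 /existsP[y0 /andP[x0O _]]]|no] :=
    boolP [exists x, exists y, isolate O A x y].
  pose phi (x : G) : delete O := insubd (Sub x0 x0O) x.
  have phiK x : x \notin O -> val (phi x) = x by move=> xO; rewrite val_insubd xO.
  apply: (@max_matching_hom G (delete O) _ (@adj (delete O)) phi).
  - move=> x y /and3P[xO yO xy].
    by rewrite -[adj _ _]/(A (val (phi x)) (val (phi y))) !phiK.
  - move=> x y x' y' /and3P[xO _ _] /and3P[yO _ _] /(congr1 val).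
    by rewrite !phiK.
  - by apply: isolate_sym; apply: adj_sym.
have [M mM <-] := max_matching_exists (isolate O A).
suff -> : M = set0 by rewrite cards0.
apply/setP => E; rewrite inE; apply/negP => /(rmatching_edge mM)[x [y [exy _]]].
by case/negP: no; apply/existsP; exists x; apply/existsP; exists y.
Qed.

Hypothesis dj : rdisjoint A.

Let T : sgraph := contract_cycles G.

Lemma support_uniq X Y x : X \in S -> Y \in S -> x \in X -> x \in Y -> X = Y.
Proof.
move=> /cycle_supportP[c cc ->] /cycle_supportP[d cd ->]; rewrite !inE => xc xd.
have E := rdisjoint_meet dj cc cd xc xd.
apply/setP => y; rewrite !inE; apply/idP/idP; first exact: cedges_eq_mem.
exact: cedges_eq_mem (esym E) _.
Qed.

Lemma block_cases X : X \in contract_blocks G ->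
  X \in S \/ exists2 x, x \notin O & X = [set x].
Proof.
rewrite inE => /orP[|/imsetP[x]]; first by left.
by rewrite inE => xO ->; right; exists x.
Qed.

Lemma block_uniq X Y x : X \in contract_blocks G -> Y \in contract_blocks G ->
  x \in X -> x \in Y -> X = Y.
Proof.
have supp Z z : Z \in S -> z \in Z -> z \in O by move=> ZS zZ; apply/bigcupP; exists Z.
case/block_cases => [XS|[a aO ->]] /block_cases[YS|[b bO ->]].
- exact: support_uniq.
- by move=> xX; rewrite inE => /eqP E; rewrite -E (supp X) in bO.
- by rewrite inE => /eqP -> /(supp _ _ YS); rewrite (negPf aO).
- by rewrite !inE => /eqP -> /eqP ->.
Qed.

Lemma block_map : exists blk : G -> T, forall x, x \in val (blk x).
Proof.
apply: (@fin_all_exists G (fun=> T : Type) (fun x (B : T) => x \in val B)) => x.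
have [xO|xO] := boolP (x \in O).
  have /bigcupP[X XS xX] := xO.
  have XB : X \in contract_blocks G by rewrite inE XS.
  by exists (Sub X XB).
have XB : [set x] \in contract_blocks G.
  by rewrite inE; apply/orP; right; apply: imset_f; rewrite inE.
by exists (Sub [set x] XB); rewrite /= inE.
Qed.

Variable blk : G -> T.
Hypothesis mem_blk : forall x, x \in val (blk x).

Lemma blk_eq x (B : T) : x \in val B -> blk x = B.
Proof. by move=> xB; apply/val_inj/block_uniq/xB/mem_blk; apply: valP. Qed.

Lemma adjTP (B1 B2 : T) : reflect
  (B1 <> B2 /\ exists x y, [/\ A x y, blk x = B1 & blk y = B2]) (adj B1 B2).
Proof.
apply: (iffP andP) => [[/eqP ne]|[ne [x [y [xy xB yB]]]]].
  case/exists_inP => x xB /exists_inP[y yB xy]; split=> //.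
  by exists x, y; rewrite (blk_eq xB) (blk_eq yB).
split; first exact/eqP.
apply/exists_inP; exists x; first by rewrite -xB.
by apply/exists_inP; exists y; rewrite // -yB.
Qed.

Lemma blk_cycle x y : x != y -> blk x = blk y ->
  exists c, [/\ rcycle A c, x \in c & y \in c].
Proof.
move=> ne E; have yB : y \in val (blk x) by rewrite E.
have xB := mem_blk x; case: (block_cases (valP (blk x))) => [|[a _ aE]].
  by move/cycle_supportP => [c cc cE]; rewrite cE !inE in xB yB; exists c.
by rewrite aE !inE in xB yB; rewrite (eqP xB) (eqP yB) eqxx in ne.
Qed.

Lemma cycle_blk c x y : rcycle A c -> x \in c -> y \in c -> blk x = blk y.
Proof.
move=> cc xc yc; have XB : [set z in c] \in contract_blocks G.
  by rewrite inE; apply/orP; left; apply/cycle_supportP; exists c.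
pose B : T := Sub [set z in c] XB.
by rewrite (@blk_eq x B) ?(@blk_eq y B) //= inE.
Qed.

Lemma blk_inj_off x y : x \notin O -> blk x = blk y -> x = y.
Proof.
move=> xO E; apply/eqP/negPn/negP => ne; have [c [cc xc _]] := blk_cycle ne E.
by case/negP: xO; apply/on_cyclesP; exists c.
Qed.

Lemma max_matching_isolate_contract : (max_matching (isolate O A) <= matching_number T)%N.
Proof.
apply: (@max_matching_hom G T _ (@adj T) blk).
- move=> x y /and3P[xO yO xy]; apply/adjTP; split; last by exists x, y.
  by move=> /(blk_inj_off xO) E; rewrite /A E adj_irrefl in xy.
- by move=> x y x' y' /and3P[xO _ _] _; apply: blk_inj_off.
- exact/isolate_sym/adj_sym.
Qed.

(** A walk in T_G avoiding the edge lifts to G, passing through blocks along their cycles and never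
    using the edge [x y]. So [x y] would lie on a cycle of G and its ends in one block. *)
Lemma contract_acyclic : acyclic (@adj T).
Proof.
have As : symmetric A := @adj_sym G.
move=> B1 B2 /adjTP[ne [x [y [xy xB yB]]]]; apply/negP => con.
have nxy c : rcycle A c -> x \in c -> y \in c -> False.
  by move=> cc xc yc; apply: ne; rewrite -xB -yB; apply: cycle_blk cc xc yc.
have inblk z w : blk z = blk w -> connect (remove_edge x y A) z w.
  have [->|zw] := eqVneq z w; first by rewrite connect0.
  move=> /(blk_cycle zw)[c [cc zc wc]].
  apply: rcycle_connect zc wc; apply: rcycle_remove => //.
  apply/negP => /cedges_mem xyc; apply: (nxy c cc); apply: xyc;
  by rewrite ?set21 ?set22.
pose P (B : T) := [forall z, (blk z == B) ==> connect (remove_edge x y A) x z].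
have PB1 : P B1 by apply/forallP => z; apply/implyP => /eqP zB; apply: inblk; rewrite zB.
have PB2 : P B2.
  apply: (connect_inv (P := P) _ PB1 con) => B B' PB /andP[/adjTP[_ [z [w [zw zB wB]]]] neB].
  apply/forallP => w'; apply/implyP => /eqP w'B.
  apply: (@connect_trans _ _ w); last by apply: inblk; rewrite wB.
  apply: (@connect_trans _ _ z).
    by have /forallP/(_ z)/implyP := PB; apply; rewrite zB.
  apply: connect1; rewrite /remove_edge zw; apply: contra neB.
  rewrite !eq_set2 => /orP[] /andP[/eqP zE /eqP wE].
    by rewrite -zB -wB zE wE xB yB !eqxx.
  by rewrite -zB -wB zE wE xB yB !eqxx orbT.
have xyc : connect (remove_edge x y A) x y.
  by have /forallP/(_ y)/implyP := PB2; apply; rewrite yB.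
have [c [cc /cedges_mem xyE]] := edge_cycle As (@adj_irrefl G) xy xyc.
by apply: (nxy c cc); apply: xyE; rewrite ?set21 ?set22.
Qed.

(* A matching of the contraction meets each cycle at most once, so it lifts and *)
(* extends by a near-perfect matching of each odd cycle.                        *)
Lemma matching_number_contract : (forall c, rcycle A c -> odd (size c)) ->
  (matching_number T + \sum_(X in S) (#|X|.-1)./2 <= max_matching A)%N.
Proof.
move=> od; have [N mN cN] := max_matching_exists (@adj T).
rewrite -[matching_number T]/(max_matching (@adj T)) -cN.
(* [h] chooses for each matched edge of T_G an edge of G above it. *)
have [h hP] : exists h : {set T} -> {set G}, forall b, b \in N ->
    exists x y, [/\ A x y, h b = [set x; y], b = [set blk x; blk y] & blk x <> blk y].
  apply: (@fin_all_exists _ (fun=> {set G}) (fun b E => b \in N ->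
    exists x y, [/\ A x y, E = [set x; y], b = [set blk x; blk y] & blk x <> blk y])) => b.
  case: (boolP (b \in N)) => bN; last by exists set0.
  have [B1 [B2 [/adjTP[ne [x [y [xy xB yB]]]] bE]]] := rmatching_edge mN bN.
  by exists [set x; y] => _; exists x, y; rewrite xB yB.
have hblk b x : b \in N -> x \in h b -> blk x \in b.
  move=> /hP[a [a' [_ -> -> _]]]; rewrite !inE.
  by move=> /orP[] /eqP ->; rewrite eqxx ?orbT.
have meet b b' x x' : b \in N -> b' \in N -> x \in h b -> x' \in h b' ->
    blk x = blk x' -> b = b' /\ x = x'.
  move=> bN b'N xb x'b' E.
  have bb' : b = b'.
    by apply: (rmatching_meet mN bN b'N (hblk _ _ bN xb)); rewrite E hblk.
  split=> //; move: xb x'b' E; rewrite -bb'; have [a [a' [_ -> _ ne]]] := hP _ bN.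
  by rewrite !inE => /orP[] /eqP -> /orP[] /eqP -> // E; case: ne.
have hne b : b \in N -> exists x, x \in h b.
  by move=> /hP[x [y [_ -> _ _]]]; exists x; rewrite set21.
have hI : {in N &, injective h}.
  move=> b b' bN b'N E; have [x xb] := hne _ bN.
  by have [] := meet b b' x x bN b'N xb; rewrite -?E.
have mhN : rmatching A (h @: N).
  apply/andP; split.
    apply/subsetP => _ /imsetP[b /hP[x [y [xy -> _ _]]] ->].
    by apply/edgeP; exists x, y.
  apply/trivIsetP => _ _ /imsetP[b bN ->] /imsetP[b' b'N ->] ne.
  apply/pred0P => x /=; apply/negbTE/negP => /andP[xb xb'].
  by case/eqP: ne; have [->] := meet _ _ _ _ bN b'N xb xb' erefl.
(* The lifted edges touch at most one vertex of the cycle, which is the vertex left out by the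
   near-perfect matching. *)
have ext X : X \in S -> exists2 F, rmatching A F & [/\ cover F \subset X,
    [disjoint cover F & cover (h @: N)] & #|F| = (#|X|.-1)./2].
  move=> /cycle_supportP[c cc ->].
  have [u uc Hu] : exists2 u, u \in c &
      forall x, x \in c -> x \in cover (h @: N) -> x = u.
    have [/exists_inP[u uc uN]|no] := boolP [exists x in c, x \in cover (h @: N)].
      exists u => // x xc /coverP[_ /imsetP[b bN ->] xb].
      have /coverP[_ /imsetP[b' b'N ->] ub'] := uN.
      by have [] := meet _ _ _ _ bN b'N xb ub' (cycle_blk cc xc uc).
    have /andP[] := cc; case: (c) no => // u p no _ _; exists u; first exact: mem_head.
    by move=> x xc xN; case/negP: no; apply/exists_inP; exists x.
  have [F mF cF] := odd_cycle_matching cc (od _ cc) uc; exists F => //; split.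
  - by rewrite cF subsetDl.
  - rewrite cF; apply/pred0P => x /=; apply/negbTE/negP; rewrite !inE.
    by case/andP => /andP[/eqP xu xc] /(Hu _ xc).
  have := card_cover_matching (@adj_irrefl G) mF.
  rewrite cF cardsDS ?sub1set ?inE // cards1 (card_cycle cc) => szF.
  by have := od _ cc; lia.
have lift s : uniq s -> {subset s <= S} -> exists M, [/\ rmatching A M,
    #|M| = (#|N| + \sum_(X <- s) (#|X|.-1)./2)%N &
    forall x, x \in cover M -> x \in cover (h @: N) \/ exists2 X, X \in s & x \in X].
  elim: s => [_ _|X s IH /= /andP[Xs us] sub].
    by exists (h @: N); split=> //; [rewrite big_nil addn0 card_in_imset | left].
  have [|M [mM cM covM]] := IH us; first by move=> Y Ys; apply: sub; rewrite inE Ys orbT.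
  have XS : X \in S by apply: sub; rewrite mem_head.
  have [F mF [FX Fdis cF]] := ext _ XS.
  have [|mU cU] := rmatching_disjointU mM mF.
    apply/pred0P => x /=; apply/negbTE/negP => /andP[/covM[xN|[Y Ys xY]] xF].
      by have /pred0P/(_ x) := Fdis; rewrite /= xF xN.
    have XY : X = Y.
      apply: support_uniq (subsetP FX _ xF) xY => //.
      by apply: sub; rewrite inE Ys orbT.
    by rewrite XY Ys in Xs.
  exists (M :|: F); split=> //; first by rewrite cU cM cF big_cons addnAC addnA.
  move=> x /coverP[E]; rewrite inE => /orP[] EM xE.
    have [?|[Y Ys xY]] := covM _ (mem_cover EM xE); first by left.
    by right; exists Y; rewrite // inE Ys orbT.
  by right; exists X; rewrite ?mem_head //; apply: (subsetP FX); apply: mem_cover EM xE.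
have [|M [mM cM _]] := lift (enum S) (enum_uniq _).
  by move=> X; rewrite mem_enum.
by rewrite -big_enum -cM max_matching_ge.
Qed.
End Contraction.

(** * The characterization of tight graphs *)

Section Characterization.
Variables (C : numClosedFieldType) (G : gain_graph C).
Let A : rel G := @adj G.

(** By counting, the edges of [M] inside a cycle cover all of it but the missed vertex, so no edge
    of [M] leaves a cycle. *)
Lemma special_matching_le M : rmatching A M ->
  (forall c, rcycle A c -> exists2 v, v \in c & v \notin cover M) ->
  (forall c, rcycle A c -> (#|inner M c|.*2).+1 = size c) ->
  (#|M| <= max_matching (isolate (on_cycles G) A) + \sum_(X in cycle_supports G) (#|X|.-1)./2)%N.
Proof.
move=> mM unc cI; set O := on_cycles G; set S := cycle_supports G.
have ei : irreflexive A := @adj_irrefl G.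
have mI c : rmatching A (inner M c).
  by apply: rmatchingS mM; apply/subsetP => E; rewrite inE => /andP[].
have inside E x : E \in M -> x \in E -> x \in O -> exists2 X, X \in S & E \subset X.
  move=> EM xE /on_cyclesP[c cc xc]; have [v vc vM] := unc _ cc.
  have covI : cover (inner M c) = [set z in c] :\ v.
    apply/eqP; rewrite eqEcard; apply/andP; split.
      apply/subsetP => z /coverP[F]; case/setIdP => FM /subsetP Fc zF.
      have := Fc _ zF; rewrite !inE => ->; rewrite andbT.
      by apply: contraNneq vM => <-; apply: mem_cover FM zF.
    rewrite (card_cover_matching ei (mI c)) cardsDS ?sub1set ?inE // cards1.
    by rewrite (card_cycle cc) -(cI _ cc) subn1.
  have : x \in cover (inner M c).
    rewrite covI !inE xc andbT; apply: contraNneq vM => <-.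
    exact: mem_cover EM xE.
  case/coverP => F; case/setIdP => FM Fc xF; exists [set z in c].
    by apply/cycle_supportP; exists c.
  by rewrite (rmatching_meet mM EM FM xE xF).
set Mo := [set E in M | [disjoint E & O]].
have sub : M \subset Mo :|: \bigcup_(X in S) [set E in M | E \subset X].
  apply/subsetP => E EM; rewrite !inE EM /=.
  case: (boolP [disjoint E & O]) => //= /pred0Pn[x /andP[xE xO]].
  have [X XS EX] := inside _ _ EM xE xO.
  by apply/bigcupP; exists X; rewrite // inE EM.
apply: leq_trans (subset_leq_card sub) _; apply: leq_trans (leq_card_setU _ _) _.
apply: leq_add; first exact/max_matching_ge/rmatching_isolate.
have -> : (\sum_(X in S) (#|X|.-1)./2 =
    \sum_(X in S) #|[set E in M | E \subset X]|)%N.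
  apply: eq_bigr => X /cycle_supportP[c cc ->].
  by rewrite (card_cycle cc) -(cI _ cc) /= doubleK.
elim/big_rec2: _ => [|X m B _ le]; first by rewrite cards0.
by apply: leq_trans (leq_card_setU _ _) _; rewrite leq_add2l.
Qed.

Lemma tightP : tight A <->
  [/\ cycles_disjoint G, forall c : seq G, is_cycle c -> typeD c &
      matching_number (contract_cycles G) = matching_number (delete (on_cycles G))].
Proof.
have sA : subgraph A := subgraph_adj G; have As := @adj_sym G; have Ai := @adj_irrefl G.
split=> [tA|[dj tD eqm]].
  have dj : rdisjoint A := tight_rdisjoint sA tA.
  have [M [mM cM unc]] := tight_matching sA tA.
  have cyc c : rcycle A c -> typeD c /\ (#|inner M c|.*2).+1 = size c.
    by move=> cc; apply: (tight_cycle_typeD sA tA cc mM cM) => d cd _; apply: unc.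
  split=> //; first by move=> c cc; case: (cyc c cc).
  have [blk blkP] := block_map G.
  have odd_c c : rcycle A c -> odd (size c) by move=> /cyc[[]].
  rewrite matching_number_delete; apply/eqP; rewrite eqn_leq.
  rewrite (max_matching_isolate_contract dj blkP) andbT.
  (* The contribution of the edges inside cycles is added to both sides, so that both compare with
     m(G). *)
  rewrite -(leq_add2r (\sum_(X in cycle_supports G) (#|X|.-1)./2)%N).
  apply: leq_trans (matching_number_contract dj blkP odd_c) _.
  rewrite -cM; apply: special_matching_le => // c /cyc[_]; exact.
have [blk blkP] := block_map G.
have [KT leKT covKT] := konig_forest (@adj_sym (contract_cycles G))
  (@adj_irrefl _) (contract_acyclic dj blkP).
have [N mN cN] := max_matching_exists (isolate (on_cycles G) A).
have {}leKT : (#|KT| <= #|N|)%N by rewrite cN -matching_number_delete -eqm.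
pose K : {set G} := [set x | (blk x \in KT) && (x \notin on_cycles G)].
have cov x y : A x y -> blk x != blk y -> (blk x \in KT) || (blk y \in KT).
  move=> xy /eqP ne; apply: covKT; apply/(adjTP dj blkP).
  by split=> //; exists x, y.
have leNK : (#|N| <= #|K|)%N.
  apply: (card_hitting mN) => E EN.
  have [x [y [/and3P[xO yO xy] ->]]] := rmatching_edge mN EN.
  have ne : blk x != blk y.
    apply/eqP => /(blk_inj_off blkP xO) E'; by rewrite /A E' Ai in xy.
  case/orP: (cov _ _ xy ne) => B; [exists x | exists y];
    by rewrite ?set21 ?set22 // inE B.
(* Since |N| <= |K| <= |KT| <= |N|, the cover [KT] consists only of blocks that are single vertices
   off the cycles. *)
have blkK : blk @: K = KT.
  apply/eqP; rewrite eqEcard card_in_imset; last first.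
    by move=> x y; rewrite inE => /andP[_ xO] _; apply: blk_inj_off.
  rewrite (leq_trans leKT leNK) andbT; apply/subsetP => _ /imsetP[x + ->].
  by rewrite inE => /andP[].
have inK x : blk x \in KT -> x \in K.
  rewrite -blkK => /imsetP[y yK E]; have := yK; rewrite inE => /andP[_ yO].
  by rewrite -(blk_inj_off blkP yO (esym E)).
have Koff c x : rcycle A c -> x \in c -> x \notin K.
  move=> cc xc; rewrite inE negb_and negbK; apply/orP; right.
  by apply/on_cyclesP; exists c.
have leKN : (#|K| <= #|N|)%N.
  apply: leq_trans leKT; rewrite -blkK card_in_imset //.
  by move=> x y; rewrite inE => /andP[_ xO] _; apply: blk_inj_off.
have low : (max_matching A)%:Z + cyc_rank A <= (ninertia A)%:Z.
  apply: (@lower_bound _ _ A K N) => //.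
  - move=> x y xy; have [E|ne] := eqVneq (blk x) (blk y).
      have xy' : x != y by apply: contraTneq xy => ->; rewrite /A Ai.
      have [c [cc xc yc]] := blk_cycle blkP xy' E.
      apply/orP; right; apply/orP; right; apply/asboolP; exists c => //.
      exact: (chordless As Ai dj cc xc yc xy).
    by case/orP: (cov _ _ xy ne) => /inK ->; rewrite ?orbT.
  - by apply: rmatching_sub mN; apply: isolate_sub.
  move=> c x cc xc; have /pred0P/(_ x)/= := cover_isolate mN.
  have -> : x \in on_cycles G by apply/on_cyclesP; exists c.
  by rewrite andbT => ->.
by apply/eqP; rewrite eq_le low ninertia_le.
Qed.
End Characterization.

Unset Implicit Arguments.

Theorem theorem3p11 (R : realType) (G : gain_graph R[i]) :
  connected G ->
  (neg_inertia G)%:Z = (matching_number G)%:Z + cyclomatic G <->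
  [/\ cycles_disjoint G,
      forall c : seq G, is_cycle c -> typeD c
    & matching_number (contract_cycles G) =
      matching_number (delete (on_cycles G)) ].
Proof. by move=> _; apply: tightP. Qed.
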